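(* Let the setting, assumptions (B1)–(B4), SPPDG iteration with a variance reduced gradient estimator, and constants be as in the context, with $M=\alpha AA^T$ and with $\alpha,\delta_1,\delta_2>0$ such that $e_0>0$. Suppose that the sequence $\{(x^k,y^k)\}$ generated by SPPDG is bounded almost surely. Then there exists an event $\mathcal{A}$ of probability $1$ such that, for all $\omega\in\mathcal{A}$: (i) the set $\mathcal{C}_\omega$ of all cluster points of $\{(x^k(\omega),y^k(\omega))\}$ is nonempty and compact, and $\mathrm{dist}((x^k(\omega),y^k(\omega)),\mathcal{C}_\omega)\to0$; (ii) $\mathcal{C}_\omega\subseteq\mathrm{crit}\,\mathcal{L}_s$; (iii) $\mathcal{L}_s$ is finite and constant on $\mathcal{C}_\omega$.
   Context: Setting. $\mathbb{X},\mathbb{Y}$ are finite-dimensional real inner product spaces with duals identified with themselves; $f_1,\dots,f_N:\mathbb{X}\to\mathbb{R}$ are continuously differentiable (possibly nonconvex), $f:=\frac1N\sum_{i=1}^Nf_i$; $A:\mathbb{X}\to\mathbb{Y}$ is linear with adjoint $A^T$; $h:\mathbb{Y}\to(-\infty,+\infty]$ is possibly nonsmooth and nonconvex with conjugate $h^*(y)=\sup_u\{\langle y,u\rangle-h(u)\}$ (convex, lower semicontinuous) and convex subdifferential $\partial h^*$. Define $\mathcal{L}_s(x,y):=f(x)+\langle y,Ax\rangle-h^*(y)$, $\partial\mathcal{L}_s(x,y):=\{\nabla f(x)+A^Ty\}\times(Ax-\partial h^*(y))$ and $\mathrm{crit}\,\mathcal{L}_s:=\{(x,y):0\in\partial\mathcal{L}_s(x,y)\}$.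 Assumptions. (B1) each $\nabla f_i$ is Lipschitz continuous on $\mathbb{X}$ with constant $L>0$. (B2) $\inf_{x\in\mathbb{X}}\mathcal{L}_s(x,y)>-\infty$ for every $y\in\mathbb{Y}^*$. (B3) $A$ is surjective. (B4) the convex hull of the function $h$ is proper. SPPDG iteration. Given $(x^0,y^0)\in\mathbb{X}\times\mathbb{Y}^*$, $\alpha>0$, $M=\alpha AA^T$, for $k\ge0$: $x^{k+1}=x^k-\alpha(\widetilde\nabla f_k+A^Ty^k)$, $y^{k+1}=\mathrm{prox}^M_{h^*}(y^k+M^{-1}A(2x^{k+1}-x^k))$, where $\mathrm{prox}^M_{h^*}(w)=\arg\min_y\{h^*(y)+\frac12\langle M(y-w),y-w\rangle\}$ and $\widetilde\nabla f_k$ is a random (stochastic gradient) estimator of $\nabla f(x^k)$. $\mathcal{F}_k$ is the $\sigma$-field generated by the random variables of the first $k$ iterations (so $(x^k,y^k)$ is $\mathcal{F}_k$-measurable), and $\mathbb{E}_k$ is expectation conditioned on $\mathcal{F}_k$. All expectations involved are understood to exist and be finite. Variance reduction. $\widetilde\nabla f_k$ is variance reduced: there are constants $\sigma_1,\sigma_2,\sigma_\Lambda>0$, $\rho\in(0,1]$ and $\mathcal{F}_k$-measurable nonnegative random variables $\Lambda_1^k=\sum_{i=1}^t(v_k^i)^2$, $\Lambda_2^k=\sum_{i=1}^tv_k^i$ (for some nonnegative real random variables $v_k^i$) such that for all $k\ge1$: (i) $\mathbb{E}_k\|\widetilde\nabla f_k-\nabla f(x^k)\|^2\le\Lambda_1^k+\sigma_1(\mathbb{E}_k\|x^{k+1}-x^k\|^2+\|x^k-x^{k-1}\|^2)$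 and $\mathbb{E}_k\|\widetilde\nabla f_k-\nabla f(x^k)\|\le\Lambda_2^k+\sigma_2(\mathbb{E}_k\|x^{k+1}-x^k\|+\|x^k-x^{k-1}\|)$; (ii) $\mathbb{E}_k[\Lambda_1^{k+1}]\le(1-\rho)\Lambda_1^k+\sigma_\Lambda(\mathbb{E}_k\|x^{k+1}-x^k\|^2+\|x^k-x^{k-1}\|^2)$; (iii) if $\lim_{k\to\infty}\mathbb{E}\|x^k-x^{k-1}\|^2=0$ then $\mathbb{E}[\Lambda_1^k]\to0$ and $\mathbb{E}[\Lambda_2^k]\to0$. Constants. $\kappa:=\sigma_1+\sigma_\Lambda/\rho$ and, for $\delta_1,\delta_2>0$, $e_0:=\frac{1}{3\alpha}-\frac{\delta_1+L}{6}-\frac{\kappa}{3\delta_1}-\frac{4\delta_2L}{3}-\frac{4\delta_2}{3\alpha}-\frac{2\delta_2\alpha L^2}{3}-\frac{\alpha L^2}{2\delta_2}-\frac{2\alpha\kappa}{\delta_2}-\frac{8\delta_2\alpha\kappa}{3}$. ''Bounded almost surely'' means there is an event of probability 1 on which the sequence $\{(x^k(\omega),y^k(\omega))\}$ is bounded for each $\omega$. *)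

(* Defs.v *)
From HB Require Import structures.
From mathcomp Require Import all_boot all_order all_algebra.
From mathcomp Require Import all_classical all_reals all_analysis.

Set Implicit Arguments.
Unset Strict Implicit.
Unset Printing Implicit Defensive.

Import Order.TTheory GRing.Theory Num.Theory.
Import numFieldNormedType.Exports.

Local Open Scope classical_set_scope.
Local Open Scope ring_scope.

(* The norm, hence the topology, is the one of the inner product. *)
HB.mixin Record NormedVector_isEuclidean (R : realType) X
    of NormedModule R X & Vector R X := {
  inner : X -> X -> R ;
  innerC : forall u v, inner u v = inner v u ;
  inner_linearl : forall (a : R) u v w,
    inner (a *: u + v) w = a * inner u w + inner v w ;
  inner_norm : forall u, inner u u = `|u| ^+ 2 }.

#[short(type="euclideanType")]
HB.structure Definition Euclidean (R : realType) :=
  {X of NormedVector_isEuclidean R X & NormedModule R X & Vector R X}.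

Lemma inner_isr {R : realType} {X : euclideanType R} (u : X) :
  linear (fun v => inner u v : R^o).
Proof. by move=> a v w; rewrite ![inner u _]innerC inner_linearl. Qed.

Lemma riesz {R : realType} {X : euclideanType R} (phi : 'Hom(X, R^o)) :
  exists g : X, forall v, phi v = inner g v.
Proof.
pose G (g : X) : 'Hom(X, R^o) := linfun (fun v => inner g v : R^o).
have GE g v : G g v = inner g v.
  pose l := GRing.isLinear.Build R X R^o _ _ (inner_isr g).
  pose L : {linear X -> R^o} := HB.pack (fun v => inner g v : R^o) l.
  by rewrite (_ : G g = linfun L) // lfunE.
have Glin : linear G.
  by move=> a u w; apply/lfunP => v; rewrite lfunE/= lfunE/= !GE inner_linearl.
pose l := GRing.isLinear.Build R X 'Hom(X, R^o) _ _ Glin.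
pose L : {linear X -> 'Hom(X, R^o)} := HB.pack G l.
pose LL := linfun L.
have LLE g v : LL g v = inner g v by rewrite lfunE/= GE.
have k0 : lker LL == 0%VS.
  apply/lker0P => u w uw.
  have : inner (u - w) (u - w) = 0 :> R.
    have e z : inner u z = inner w z :> R by rewrite -!LLE uw.
    by rewrite -{1}[u - w](_ : (-1) *: w + u = _) ?inner_linearl ?e ?mulN1r ?addNr// scaleN1r addrC.
  by rewrite inner_norm => /eqP; rewrite sqrf_eq0 normr_eq0 subr_eq0 => /eqP.
have d1 : \dim (limg LL) = \dim {:'Hom(X, R^o)}.
  rewrite limg_dim_eq; last by rewrite (eqP k0) capv0.
  by rewrite !dimvf /dim/= muln1.
have full : (limg LL)%VS = fullv by apply/eqP; rewrite eqEdim subvf d1 leqnn.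
have : phi \in limg LL by rewrite full memvf.
by case/memv_imgP => g _ ->; exists g => v; rewrite LLE.
Qed.

Definition adjoint {R : realType} {X Y : euclideanType R} (A : 'Hom(X, Y)) :
    'Hom(Y, X) :=
  xget 0 [set B : 'Hom(Y, X) |
    forall x y, inner (A x) y = inner x (B y)].

Lemma adjointP {R : realType} {X Y : euclideanType R} (A : 'Hom(X, Y)) x y :
  inner (A x) y = inner x (adjoint A y) :> R.
Proof.
rewrite /adjoint; case: xgetP => [B _ HB|H]; first exact: HB.
exfalso.
have e (y2 : Y) : exists g : X, forall x2, inner (A x2) y2 = inner g x2 :> R.
  pose f (x2 : X) : R^o := inner (A x2) y2.
  have lf : linear f by move=> a u w; rewrite /f linearP inner_linearl.
  pose l := GRing.isLinear.Build R X R^o _ _ lf.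
  pose L : {linear X -> R^o} := HB.pack f l.
  have [g Hg] := riesz (linfun L); exists g => z; rewrite -Hg lfunE//.
pose b y2 := sval (cid (e y2)).
have bE y' z : inner (A z) y' = inner (b y') z :> R by rewrite /b; case: cid.
have blin : linear b.
  move=> a u w; apply/eqP; rewrite -subr_eq0 -normr_eq0 -sqrf_eq0 -inner_norm.
  have H3 z : inner (b (a *: u + w) - (a *: b u + b w)) z = 0 :> R.
    have -> : b (a *: u + w) - (a *: b u + b w) = (-1) *: (a *: b u + b w) + b (a *: u + w).
      by rewrite scaleN1r [RHS]addrC.
    have H4 : inner (b (a *: u + w)) z = a * inner (b u) z + inner (b w) z :> R.
      by rewrite -!bE ![inner (A z) _]innerC inner_linearl.
    by rewrite 2!inner_linearl H4 mulN1r addNr.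
  by rewrite H3.
pose l := GRing.isLinear.Build R Y X _ _ blin.
pose L : {linear Y -> X} := HB.pack b l.
by apply: (H (linfun L)) => u v; rewrite lfunE/= bE innerC.
Qed.

(* Meaningful where [f] is differentiable. *)
Definition grad {R : realType} {X : euclideanType R} (f : X -> R) (x : X) : X :=
  xget 0 [set g : X | forall v, 'd f x v = inner g v].

Lemma gradP {R : realType} {X : euclideanType R} (f : X -> R) (x v : X) :
  'd f x v = inner (grad f x) v :> R.
Proof.
rewrite /grad; case: xgetP => [B _ HB|H]; first exact: HB.
exfalso.
have [g Hg] := riesz (linfun ('d f x)).
by apply: (H g) => u; rewrite -Hg lfunE.
Qed.

Definition C1 {R : realType} {X : euclideanType R} (f : X -> R) : Prop :=
  (forall x, differentiable f x) /\ continuous (grad f).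

Definition conjugate {R : realType} {Y : euclideanType R} (h : Y -> \bar R)
    (y : Y) : \bar R :=
  ereal_sup [set (inner y u)%:E - h u | u in setT]%E.

Definition subdifferential {R : realType} {Y : euclideanType R}
    (phi : Y -> \bar R) (y : Y) : set Y :=
  [set s | phi y \is a fin_num /\
           forall z, (phi y + (inner s (z - y))%:E <= phi z)%E].

Definition epigraph {R : realType} {Y : euclideanType R} (h : Y -> \bar R) :
    set (Y * R^o) :=
  [set z | (h z.1 <= z.2%:E)%E].

(* The largest convex function below [h]: the lower boundary of the convex hull
   of its epigraph. *)
Definition convex_hull_fun {R : realType} {Y : euclideanType R}
    (h : Y -> \bar R) (u : Y) : \bar R :=
  ereal_inf [set m%:E | m in
    [set m : R | smallest (@convex_set R (Y * R^o)%type) (epigraph h) (u, m)]].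

Definition proper_fun {R : realType} {Y : euclideanType R}
    (phi : Y -> \bar R) : Prop :=
  (exists u, phi u < +oo)%E /\ (forall u, -oo < phi u)%E.

Definition prox {R : realType} {Y : euclideanType R} (phi : Y -> \bar R)
    (M : 'End(Y)) (w : Y) : set Y :=
  let obj y := (phi y + (2^-1 * inner (M (y - w)) (y - w))%:E)%E in
  [set y | forall z, (obj y <= obj z)%E].

Definition Ls {R : realType} {X Y : euclideanType R} (f : X -> R)
    (A : 'Hom(X, Y)) (h : Y -> \bar R) (x : X) (y : Y) : \bar R :=
  ((f x + inner y (A x))%:E - conjugate h y)%E.

Definition subdiff_Ls {R : realType} {X Y : euclideanType R} (f : X -> R)
    (A : 'Hom(X, Y)) (h : Y -> \bar R) (x : X) (y : Y) : set (X * Y) :=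
  [set grad f x + adjoint A y] `*`
  [set A x - s | s in subdifferential (conjugate h) y].

Definition crit_Ls {R : realType} {X Y : euclideanType R} (f : X -> R)
    (A : 'Hom(X, Y)) (h : Y -> \bar R) : set (X * Y) :=
  [set z | subdiff_Ls f A h z.1 z.2 (0, 0)].

Definition average {R : realType} {X : euclideanType R} {N : nat}
    (fi : 'I_N -> X -> R) (x : X) : R :=
  N%:R^-1 * \sum_(i < N) fi i x.

(* Distance for the inner product norm of the product space; the library's norm
   on [X * Y] is the maximum norm. *)
Definition dist_set {R : realType} {X Y : euclideanType R} (z : X * Y)
    (C : set (X * Y)) : R :=
  inf [set Num.sqrt (`|z.1 - c.1| ^+ 2 + `|z.2 - c.2| ^+ 2) | c in C].

Definition cluster_points {R : realType} {X Y : euclideanType R}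
    (z : nat -> X * Y) : set (X * Y) :=
  cluster (z @ \oo).

Definition borel (U : topologicalType) : set (set U) := <<s @open U >>.

(* [f] is measurable from the sigma-algebra [G] to the sigma-algebra [B]. *)
Definition measurable_wrt {T U : Type} (G : set (set T)) (B : set (set U))
    (f : T -> U) : Prop :=
  forall b, B b -> G (f @^-1` b).

(* The sigma-algebra generated by [xi 0, ..., xi k.-1]. *)
Definition history {T : Type} {d : measure_display}
    {S : nat -> measurableType d} (xi : forall j, T -> S j) (k : nat) :
    set (set T) :=
  <<s \bigcup_(j in [set j | (j < k)%N])
        preimage_set_system setT (xi j) measurable >>.

Definition is_condexp {d : measure_display} {T : measurableType d}
    {R : realType} (P : probability T R) (G : set (set T)) (Z W : T -> R) :
    Prop :=
  [/\ measurable_wrt G (@measurable _ R) W,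
      P.-integrable setT (EFin \o W) &
      forall B, G B ->
        (\int[P]_(w in B) (W w)%:E = \int[P]_(w in B) (Z w)%:E)%E].

(* A version of the conditional expectation of [Z] given [G]; meaningful for
   integrable [Z]. *)
Definition condexp {d : measure_display} {T : measurableType d}
    {R : realType} (P : probability T R) (G : set (set T)) (Z : T -> R) :
    T -> R :=
  xget (cst 0) [set W | is_condexp P G Z W].

Definition primal_step {T : Type} {R : realType} {X : euclideanType R}
    (x : nat -> T -> X) (k : nat) (w : T) : R :=
  `|x k w - x k.-1 w|.

Definition grad_error {T : Type} {R : realType} {X : euclideanType R}
    (f : X -> R) (x g : nat -> T -> X) (k : nat) (w : T) : R :=
  `|g k w - grad f (x k w)|.

Definition Lambda1 {T : Type} {R : realType} {t : nat}
    (v : nat -> 'I_t -> T -> R) (k : nat) (w : T) : R :=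
  \sum_(i < t) v k i w ^+ 2.

Definition Lambda2 {T : Type} {R : realType} {t : nat}
    (v : nat -> 'I_t -> T -> R) (k : nat) (w : T) : R :=
  \sum_(i < t) v k i w.

Record is_sppdg {T : Type} {R : realType} {X Y : euclideanType R} (alpha : R)
    (A : 'Hom(X, Y)) (h : Y -> \bar R) (x0 : X) (y0 : Y)
    (g x : nat -> T -> X) (y : nat -> T -> Y) : Prop := {
  sppdg_x0 : forall w, x 0%N w = x0 ;
  sppdg_y0 : forall w, y 0%N w = y0 ;
  sppdg_x : forall k w,
    x k.+1 w = x k w - alpha *: (g k w + adjoint A (y k w)) ;
  sppdg_y : forall k w,
    let M : 'End(Y) := alpha *: (A \o adjoint A)%VF in
    prox (conjugate h) M
      (y k w + (M^-1)%VF (A (2 *: x k.+1 w - x k w))) (y k.+1 w) }.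

Record variance_reduced {d : measure_display} {T : measurableType d}
    {R : realType} {X : euclideanType R} (P : probability T R)
    (F : nat -> set (set T)) (f : X -> R) (x g : nat -> T -> X) {t : nat}
    (v : nat -> 'I_t -> T -> R) (sigma1 sigma2 sigmaL rho : R) : Prop := {
  vr_v_ge0 : forall k i w, (0 < k)%N -> 0 <= v k i w ;
  vr_v_measurable : forall k i, (0 < k)%N -> measurable_fun setT (v k i) ;
  vr_Lambda1_adapted : forall k, (0 < k)%N ->
    measurable_wrt (F k) (@measurable _ R) (Lambda1 v k) ;
  vr_Lambda2_adapted : forall k, (0 < k)%N ->
    measurable_wrt (F k) (@measurable _ R) (Lambda2 v k) ;
  (* all the expectations below are finite *)
  vr_Lambda1_integrable : forall k, (0 < k)%N ->
    P.-integrable setT (EFin \o Lambda1 v k) ;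
  vr_Lambda2_integrable : forall k, (0 < k)%N ->
    P.-integrable setT (EFin \o Lambda2 v k) ;
  vr_step_integrable : forall k, (0 < k)%N ->
    P.-integrable setT (EFin \o primal_step x k) ;
  vr_step2_integrable : forall k, (0 < k)%N ->
    P.-integrable setT (fun w => (primal_step x k w ^+ 2)%:E) ;
  vr_error_integrable : forall k, (0 < k)%N ->
    P.-integrable setT (EFin \o grad_error f x g k) ;
  vr_error2_integrable : forall k, (0 < k)%N ->
    P.-integrable setT (fun w => (grad_error f x g k w ^+ 2)%:E) ;
  vr_mean_square : forall k, (0 < k)%N -> \forall w \ae P,
    condexp P (F k) (fun w => grad_error f x g k w ^+ 2) w <=
    Lambda1 v k w +
    sigma1 * (condexp P (F k) (fun w => primal_step x k.+1 w ^+ 2) w +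
              primal_step x k w ^+ 2) ;
  vr_mean_norm : forall k, (0 < k)%N -> \forall w \ae P,
    condexp P (F k) (grad_error f x g k) w <=
    Lambda2 v k w +
    sigma2 * (condexp P (F k) (primal_step x k.+1) w + primal_step x k w) ;
  vr_decay : forall k, (0 < k)%N -> \forall w \ae P,
    condexp P (F k) (Lambda1 v k.+1) w <=
    (1 - rho) * Lambda1 v k w +
    sigmaL * (condexp P (F k) (fun w => primal_step x k.+1 w ^+ 2) w +
              primal_step x k w ^+ 2) ;
  vr_limit :
    ('E_P[(fun w => primal_step x k w ^+ 2)%R] @[k --> \oo] --> 0)%E ->
    ('E_P[Lambda1 v k] @[k --> \oo] --> 0)%E /\
    ('E_P[Lambda2 v k] @[k --> \oo] --> 0)%E }.

Definition e0 {R : realType}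
    (alpha L delta1 delta2 sigma1 sigmaL rho : R) : R :=
  let kappa := sigma1 + sigmaL / rho in
  1 / (3 * alpha) - (delta1 + L) / 6 - kappa / (3 * delta1)
  - 4 * delta2 * L / 3 - 4 * delta2 / (3 * alpha)
  - 2 * delta2 * alpha * L ^+ 2 / 3 - alpha * L ^+ 2 / (2 * delta2)
  - 2 * alpha * kappa / delta2 - 8 * delta2 * alpha * kappa / 3.

(* Main.v *)
(* Write [d_k = x^k - x^(k-1)] and [e_k = g_k - grad f (x^k)].  Optimality in the
   proximal step makes [A (x^(k+1) + alpha (g_k - g_(k-1)))] a subgradient of
   [h^*] at [y^k]; hence the energy [L_s (x^(k+1), y^k)] decreases from one
   iteration to the next up to a quadratic form in the [d]'s and [e]'s.

   The trajectories are bounded only almost surely, so this energy may fail to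
   be integrable or to be bounded below in the mean.  We therefore restrict to
   the events [E_k = {|x^j| <= r and |y^j| <= r for all j <= k}].  They decrease
   and belong to [F_k], so the variance reduction inequalities can be integrated
   over them, and on [E_k] the energy at [(x^(k+1), y^k)] is bounded below because
   [inf_x L_s (x, .)] is a finite concave function, hence bounded below on balls.
   Summing up, [e0 > 0] gives [sum_k E (1_(E_k) (|d_(k+1)|^2 + |e_k|^2)) < oo].
   Letting [r] range over the naturals, almost surely [sum_k |d_k|^2 + |e_k|^2]
   is finite.

   On such a trajectory [d_k] and [e_k] tend to [0] and the energy converges.
   Along a subsequence converging to [(x, y)], the subgradient inequalities at
   the [y^k] and the lower semicontinuity of [h^*] force [h^* (y^k) -> h^* (y)],
   so [(x, y)] is critical and [L_s (x, y)] is the limit of the energy. *)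

Require Import Defs.
From HB Require Import structures.
From mathcomp Require Import all_boot all_order all_algebra.
From mathcomp Require Import all_classical all_reals all_analysis.
From mathcomp Require Import measurable_realfun.
From mathcomp Require Import ring lra.

Set Implicit Arguments.
Unset Strict Implicit.
Unset Printing Implicit Defensive.

Import Order.TTheory GRing.Theory Num.Theory.
Import numFieldNormedType.Exports.

Local Open Scope classical_set_scope.
Local Open Scope ring_scope.

(** * Euclidean spaces *)

Section inner_product.
Context {R : realType} {X : euclideanType R}.
Implicit Types u v w : X.

Lemma innerDl u v w : inner (u + v) w = inner u w + inner v w :> R.
Proof. by rewrite -[u]scale1r inner_linearl mul1r scale1r. Qed.

Lemma inner0l w : inner 0 w = 0 :> R.
Proof. by apply: (@addrI _ (inner 0 w)); rewrite -innerDl !addr0. Qed.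

Lemma innerZl (a : R) u w : inner (a *: u) w = a * inner u w.
Proof. by rewrite -[a *: u]addr0 inner_linearl inner0l addr0. Qed.

Lemma innerNl u w : inner (- u) w = - inner u w :> R.
Proof. by rewrite -scaleN1r innerZl mulN1r. Qed.

Lemma innerBl u v w : inner (u - v) w = inner u w - inner v w :> R.
Proof. by rewrite innerDl innerNl. Qed.

Lemma innerDr u v w : inner w (u + v) = inner w u + inner w v :> R.
Proof. by rewrite innerC innerDl ![inner _ w]innerC. Qed.

Lemma inner0r w : inner w 0 = 0 :> R.
Proof. by rewrite innerC inner0l. Qed.

Lemma innerZr (a : R) u w : inner w (a *: u) = a * inner w u.
Proof. by rewrite innerC innerZl innerC. Qed.

Lemma innerNr u w : inner w (- u) = - inner w u :> R.
Proof. by rewrite innerC innerNl innerC. Qed.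

Lemma innerBr u v w : inner w (u - v) = inner w u - inner w v :> R.
Proof. by rewrite innerDr innerNr. Qed.

Lemma inner_ge0 u : 0 <= inner u u :> R.
Proof. by rewrite inner_norm sqr_ge0. Qed.

Lemma sqnormD u v : `|u + v| ^+ 2 = `|u| ^+ 2 + 2 * inner u v + `|v| ^+ 2 :> R.
Proof.
by rewrite -!inner_norm innerDl !innerDr [inner v u]innerC; ring.
Qed.

Lemma inner_young u v (c : R) : 0 < c ->
  inner u v <= c / 2 * `|u| ^+ 2 + (2 * c)^-1 * `|v| ^+ 2.
Proof.
move=> c0; have := inner_ge0 (c *: u - v).
rewrite innerBl !innerBr !innerZl !innerZr [inner v u]innerC !inner_norm => h.
rewrite -(ler_pM2l (_ : 0 < 2 * c)) ?mulr_gt0// mulrDr (mulrA _ (_^-1)).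
rewrite divff ?mulf_neq0 ?lt0r_neq0// mul1r.
rewrite (_ : 2 * c * (c / 2 * `|u| ^+ 2) = c * (c * `|u| ^+ 2)); last by field.
lra.
Qed.

Lemma cauchy_schwarz u v : `|inner u v| <= `|u| * `|v| :> R.
Proof.
have key w z : inner w z <= `|w| * `|z| :> R.
  have [->|w0] := eqVneq w 0; first by rewrite inner0l normr0 mul0r.
  have [->|z0] := eqVneq z 0; first by rewrite inner0r normr0 mulr0.
  have wp : 0 < `|w| by rewrite normr_gt0.
  have zp : 0 < `|z| by rewrite normr_gt0.
  (* The weight [|z| / |w|] makes both terms of Young's inequality equal to [|w| |z| / 2]. *)
  apply: le_trans (@inner_young w z (`|z| / `|w|) _) _; first exact: divr_gt0.
  rewrite le_eqVlt; apply/orP; left; apply/eqP.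
  by field; rewrite !gt_eqF.
rewrite ler_norml key andbT lerNl -innerNl -(normrN u); exact: key.
Qed.

Lemma sqnormB_le u v : `|u - v| ^+ 2 <= 2 * (`|u| ^+ 2 + `|v| ^+ 2) :> R.
Proof.
have := inner_ge0 (u + v); have := sqnormD u v; have := sqnormD u (- v).
by rewrite inner_norm innerNr normrN; lra.
Qed.

Lemma inner_cvg {I : Type} (F : set_system I) {FF : Filter F} (f g : I -> X) u v :
  f @ F --> u -> g @ F --> v ->
  (fun i => inner (f i) (g i)) @ F --> (inner u v : R).
Proof.
move=> fu gv.
have gn : (fun i => `|g i|) @ F --> (`|v| : R) by apply: cvg_norm.
have fn : (fun i => `|f i - u|) @ F --> (0 : R).
  by rewrite -(normr0 X) -(subrr u); apply: cvg_norm; apply: cvgB => //; exact: cvg_cst.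
have gn2 : (fun i => `|g i - v|) @ F --> (0 : R).
  by rewrite -(normr0 X) -(subrr v); apply: cvg_norm; apply: cvgB => //; exact: cvg_cst.
have h0 : (fun i => `|f i - u| * `|g i| + `|u| * `|g i - v|) @ F --> (0 : R).
  rewrite -[X in _ --> X](_ : 0 * `|v| + `|u| * 0 = 0); last by rewrite mul0r mulr0 addr0.
  by apply: cvgD; [apply: cvgM|apply: cvgM => //; exact: cvg_cst].
have : (fun i => inner (f i) (g i) - inner u v : R) @ F --> (0 : R).
  apply/norm_cvg0P; apply: (squeeze_cvgr _ (cvg_cst (0 : R)) h0).
  apply: nearW => i; rewrite normr_ge0/=.
  rewrite (_ : inner (f i) (g i) - inner u v =
    inner (f i - u) (g i) + inner u (g i - v)); last first.
    by rewrite innerBl innerBr; ring.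
  by rewrite (le_trans (ler_normD _ _))// lerD ?cauchy_schwarz.
by move/subr_cvg0.
Qed.

End inner_product.

Lemma closed_norm_le {R : realType} {V : normedModType R} (r : R) :
  closed [set u : V | `|u| <= r].
Proof.
exact: (@closed_comp _ _ (fun u : V => `|u|) [set t : R | t <= r]
  (fun u _ => @norm_continuous _ _ u) (@closed_le _ _)).
Qed.

Section finite_dimension.
Context {R : realType} {X : euclideanType R}.

(** A coordinate is a linear functional, so [riesz], which is purely algebraic, represents it by a
    vector and Cauchy-Schwarz bounds it. *)
Lemma coord_vbasis_bounded : exists2 c : R, 0 <= c &
  forall i u, `|coord (vbasis {:X}) i u| <= c * `|u|.
Proof.
have /choice[r hr] (i : 'I_(\dim {:X})) :
    exists r : X, forall u, coord (vbasis {:X}) i u = inner r u.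
  have [r hr] := riesz (linfun (coord (vbasis {:X}) i : X -> R^o)).
  by exists r => u; rewrite -hr lfunE.
exists (\sum_i `|r i|) => [|i u]; first exact: sumr_ge0.
rewrite hr (le_trans (cauchy_schwarz _ _))// ler_wpM2r//.
by rewrite (bigD1 i)//= lerDl sumr_ge0.
Qed.

Lemma euclidean_linear_bounded {Y : normedModType R} (f : {linear X -> Y}) :
  exists2 c : R, 0 <= c & forall u, `|f u| <= c * `|u|.
Proof.
have [c c0 hc] := coord_vbasis_bounded.
exists (c * \sum_(i < \dim {:X}) `|f (vbasis {:X})`_i|) => [|u].
  by rewrite mulr_ge0// sumr_ge0.
rewrite {1}(coord_vbasis (memvf u)) linear_sum mulrAC mulr_sumr.
apply: le_trans (ler_norm_sum _ _ _) _; apply: ler_sum => i _.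
by rewrite linearZ/= normrZ ler_wpM2r.
Qed.

Lemma euclidean_linear_continuous {Y : normedModType R} (f : {linear X -> Y}) : continuous f.
Proof.
have [c c0 fc] := euclidean_linear_bounded f; apply/bounded_linear_continuous/linear_boundedP.
exists c; split => [|r cr u]; first exact: num_real.
by rewrite (le_trans (fc u))// ler_wpM2r// ltW.
Qed.

(** The ball is a closed subset of the image of a compact ball of row vectors under the continuous
    map [V], which rebuilds a vector from its coordinates. *)
Lemma euclidean_ball_compact (r : R) : compact [set u : X | `|u| <= r].
Proof.
pose n := \dim {:X}; pose b := vbasis {:X}.
pose V (c : 'rV[R]_n) : X := \sum_(i < n) c ord0 i *: b`_i.
have Vlin : linear V.
  move=> a c e; rewrite /V scaler_sumr -big_split/=; apply: eq_bigr => i _.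
  by rewrite !mxE scalerDl scalerA.
pose VL : {linear 'rV[R]_n -> X} := HB.pack V (GRing.isLinear.Build R _ X _ V Vlin).
have Vc : continuous VL.
  apply: continuous_big => [|i _ c]; first exact: add_continuous.
  apply: (@cvgZr_tmp _ _ _ (nbhs c)); exact: (@coord_continuous R 1 n ord0 i).
pose W (u : X) : 'rV[R]_n := \row_i coord b i u.
have Wlin : linear W by move=> a c e; apply/rowP => i; rewrite !mxE linearP.
pose WL : {linear X -> 'rV[R]_n} := HB.pack W (GRing.isLinear.Build R X _ _ W Wlin).
have VW u : V (W u) = u.
  rewrite /V [RHS](coord_vbasis (memvf u)); apply: eq_bigr => i _.
  by rewrite !mxE.
have [c c0 Wc] := euclidean_linear_bounded WL.
have comp : compact [set e : 'rV[R]_n | `|e| <= c * r].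
  apply: bounded_closed_compact.
    by exists (c * r); split=> [|t rt e /= /le_trans]; [exact: num_real|apply; exact: ltW].
  exact: closed_norm_le.
apply: subclosed_compact (@closed_norm_le _ X r) (continuous_compact (continuous_subspaceT Vc) comp) _.
move=> u /= ur; exists (W u); last exact: VW.
by rewrite /= (le_trans (Wc u))// ler_wpM2l.
Qed.

End finite_dimension.

(** * Gradients *)

Section gradient.
Context {R : realType} {X : euclideanType R}.

(** Also a tool: it reduces vector identities to scalar ones, which [ring] and [field] decide. *)
Lemma inner_eq (u v : X) : (forall w, inner u w = inner v w :> R) -> u = v.
Proof.
move=> uv; apply/eqP; rewrite -subr_eq0 -normr_eq0 -sqrf_eq0 -inner_norm.
by rewrite innerBl uv subrr.
Qed.

Lemma grad_average N (fi : 'I_N -> X -> R) (a : X) :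
  (forall i, differentiable (fi i) a) ->
  differentiable (average fi) a /\
  grad (average fi) a = N%:R^-1 *: \sum_(i < N) grad (fi i) a.
Proof.
move=> df.
have E : average fi = (N%:R^-1 : R) *: (\sum_(i < N) fi i).
  by apply/funext => u; rewrite /average fctE fct_sumE.
have ds : differentiable (\sum_(i < N) fi i) a by exact: differentiable_sum.
have da : differentiable (average fi) a by rewrite E; exact: differentiableZ.
split => //; apply: inner_eq => w.
rewrite -gradP -deriveE// E deriveZ; last exact: diff_derivable.
rewrite derive_sum; last by move=> i; exact: diff_derivable.
rewrite innerZl; congr (_ * _).
elim/big_ind2 : _ => [|u r v s -> ->|i _]; rewrite ?inner0l ?innerDl//.
by rewrite deriveE// gradP.
Qed.

Lemma grad_average_lipschitz N (fi : 'I_N -> X -> R) (L : R) : (0 < N)%N ->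
  (forall i a, differentiable (fi i) a) ->
  (forall i a b, `|grad (fi i) a - grad (fi i) b| <= L * `|a - b|) ->
  forall a b, `|grad (average fi) a - grad (average fi) b| <= L * `|a - b|.
Proof.
move=> N0 df lip a b.
have [_ ->] := grad_average (fun i => df i a).
have [_ ->] := grad_average (fun i => df i b).
rewrite -scalerBr -sumrB normrZ normfV normr_nat ler_pdivrMl ?ltr0n//.
apply: le_trans (ler_norm_sum _ _ _) _.
apply: le_trans (ler_sum _ (fun i _ => lip i a b)) _.
by rewrite sumr_const card_ord -[X in X <= _]mulr_natl.
Qed.

Let is_derive_quadratic (p m t : R) :
  is_derive t 1 (fun s => s * p + s ^+ 2 * m) (p + 2 * t * m).
Proof.
rewrite (_ : (fun _ => _) = (p \*: id) + (m \*: (id ^+ 2))).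
  have dX := is_deriveX 2 (is_derive_id t 1).
  apply: (is_derive_eq (is_deriveD (is_deriveZ p (is_derive_id t 1)) (is_deriveZ m dX))).
  by rewrite /GRing.scale/=; ring.
by apply/funext => s; rewrite !fctE /GRing.scale/= mulrC [X in _ + X]mulrC.
Qed.

(** The mean value theorem on [[0, 1]] for [q], the gap between [f] on the segment and its quadratic
    model: the Lipschitz gradient makes the derivative of [q] nonpositive. *)
Lemma descent_lemma (f : X -> R) (L : R) : (forall a, differentiable f a) ->
  (forall a b, `|grad f a - grad f b| <= L * `|a - b|) ->
  forall a b, f b <= f a + inner (grad f a) (b - a) + L / 2 * `|b - a| ^+ 2.
Proof.
move=> df lip a b; set v := b - a.
pose q t := f (t *: v + a) - (t * inner (grad f a) v + t ^+ 2 * (L / 2 * `|v| ^+ 2)).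
pose dq t := inner (grad f (t *: v + a)) v -
  (inner (grad f a) v + 2 * t * (L / 2 * `|v| ^+ 2)).
have dl (t : R) : is_derive t 1 (fun t : R => f (t *: v + a)) (inner (grad f (t *: v + a)) v).
  have E : (fun h : R => h^-1 *: (f ((h *: (1 : R) + t) *: v + a) - f (t *: v + a))) =
           (fun h => h^-1 *: (f (h *: v + (t *: v + a)) - f (t *: v + a))).
    by apply/funext => h; rewrite scalerDl /GRing.scale/= mulr1 addrA.
  apply: DeriveDef.
    by rewrite /derivable; under eq_fun do rewrite /=; rewrite E; exact/diff_derivable.
  by rewrite -gradP -deriveE// /derive; exact: (congr1 (fun u => lim (u @ (0 : R)^')) E).
have dqE (t : R) : is_derive t 1 q (dq t).
  apply: is_deriveB; exact: is_derive_quadratic.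
have [] := @MVT _ q dq 0 1 ltr01 (fun x _ => dqE x).
  apply: derivable_within_continuous => t _; by have [] := dqE t.
move=> c /[!in_itv]/= /andP[c0 c1].
rewrite subr0 mulr1 => qE.
suff : dq c <= 0.
  rewrite -qE /q scale1r /v subrK scale0r add0r; lra.
have := cauchy_schwarz (grad f (c *: v + a) - grad f a) v.
rewrite ler_norml => /andP[_]; rewrite innerBl.
have := lip (c *: v + a) a; rewrite addrK normrZ gtr0_norm// => h1.
have := ler_wpM2r (normr_ge0 v) h1.
rewrite /dq; move: (inner _ v) (inner _ v) => p p'.
move: (`|grad f _ - grad f a| * `|v|) => n h2 h3; lra.
Qed.

End gradient.

(** * Suprema of affine functions and the conjugate *)

(** [H] is the real-valued pointwise supremum of the affine functions with slope [a.1] and constant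
    [a.2]. Stated by upper bounds, it yields convexity and lower semicontinuity without handling a
    [sup]. *)
Definition affine_sup {R : realType} {Y : euclideanType R} (D : set (Y * R))
    (H : Y -> R) : Prop :=
  forall y m, H y <= m <-> forall a, D a -> inner y a.1 + a.2 <= m.

Lemma le0_of_le_mul {R : realType} (a b : R) :
  (forall t, 0 < t <= 1 -> a <= t * b) -> a <= 0.
Proof.
move=> ab; rewrite leNgt; apply/negP => a0.
have c0 : 0 < `|b| + 1 by rewrite ltr_wpDl.
have ac0 : 0 < a / (2 * (`|b| + 1)) by rewrite divr_gt0// mulr_gt0.
(* This [t] makes [t * b <= a / 2]; when it exceeds 1, then [a > 2 * (|b| + 1)] and [t = 1] already
   contradicts. *)
have [c1|c1] := leP (a / (2 * (`|b| + 1))) 1.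
- have := ab _ (introT andP (conj ac0 c1)).
  rewrite mulrAC ler_pdivlMr ?mulr_gt0// ler_pM2l//.
  by have := ler_norm b; have := normr_ge0 b; lra.
- have := ab 1; rewrite ltr01 lexx mul1r => /(_ isT).
  move: c1; rewrite ltr_pdivlMr ?mulr_gt0// mul1r.
  by have := ler_norm b; have := normr_ge0 b; lra.
Qed.

Section affine_families.
Context {R : realType} {Y : euclideanType R}.
Implicit Types (D : set (Y * R)) (H : Y -> R) (y z : Y).

(* An affine function on a cube is bounded by its value at a vertex, and there
   are finitely many vertices. *)
Lemma affine_family_bounded D :
  (forall y, exists m, forall a, D a -> inner y a.1 + a.2 <= m) ->
  forall r, exists m, forall y a, `|y| <= r -> D a -> inner y a.1 + a.2 <= m.
Proof.
move=> /choice[B hB] r.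
pose n := \dim {:Y}; pose b := vbasis {:Y}.
have [c c0 hc] := @coord_vbasis_bounded R Y.
pose vertex (s : {ffun 'I_n -> bool}) : Y := \sum_i ((-1) ^+ s i * (c * r)) *: b`_i.
exists (\sum_s `|B (vertex s)|) => y a yr Da.
(* The vertex whose coordinates have the signs of the [inner b_i a.1] maximizes the linear part over
   the cube. *)
pose s : {ffun 'I_n -> bool} := [ffun i : 'I_n => inner b`_i a.1 < (0 : R)].
apply: (@le_trans _ _ (inner (vertex s) a.1 + a.2)); last first.
  apply: le_trans (hB _ _ Da) _; rewrite (bigD1 s)//=.
  by apply: le_trans (ler_norm _) _; rewrite lerDl sumr_ge0.
rewrite lerD2r {1}(coord_vbasis (memvf y)) /vertex.
elim/big_ind2 : _ => [|u1 r1 u2 r2 h1 h2|i _]; first by rewrite inner0l.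
  by rewrite !innerDl lerD.
rewrite !innerZl ffunE.
have ci : `|coord b i y| <= c * r.
  by rewrite (le_trans (hc i y))// ler_wpM2l.
move: ci; rewrite ler_norml => /andP[ci1 ci2].
have [ba|ba] := ltP (inner b`_i a.1) (0 : R).
  by rewrite expr1 mulN1r; apply: ler_wnM2r => //; exact: ltW.
by rewrite expr0 mul1r; apply: ler_wpM2r.
Qed.

Lemma affine_sup_ge D H y a : affine_sup D H -> D a -> inner y a.1 + a.2 <= H y.
Proof. by move=> DH Da; apply: (DH y (H y)).1. Qed.

Lemma affine_sup_convex D H : affine_sup D H -> forall y z t, 0 <= t <= 1 ->
  H (y + t *: (z - y)) <= (1 - t) * H y + t * H z.
Proof.
move=> DH y z t /andP[t0 t1]; apply/DH => a Da.
rewrite innerDl innerZl innerBl.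
rewrite (_ : _ + _ + _ = (1 - t) * (inner y a.1 + a.2) + t * (inner z a.1 + a.2)); last by ring.
by rewrite lerD// ler_wpM2l ?subr_ge0//; exact: affine_sup_ge.
Qed.

Lemma affine_sup_lsc D H (u : nat -> Y) (m : nat -> R) y l : affine_sup D H ->
  u @ \oo --> y -> m @ \oo --> l -> (forall i, H (u i) <= m i) -> H y <= l.
Proof.
move=> DH uy ml um; apply/DH => a Da.
apply: (ler_cvg_to _ ml).
  apply: cvgD; last exact: cvg_cst.
  by apply: inner_cvg uy _; exact: cvg_cst.
by apply: nearW => i; apply: le_trans (um i); exact: affine_sup_ge.
Qed.

(** Compare [y1] with [y1 + t (z - y1)], using convexity of [H]. After division by [t], the
    second-order term is [t / 2 * inner (M (z - y1)) (z - y1)], which vanishes as [t] tends to 0;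
    symmetry of [M] merges the cross terms. *)
Lemma argmin_prox_subgradient D H (M : 'End(Y)) w y1 : affine_sup D H ->
  (forall u v, inner (M u) v = inner u (M v) :> R) ->
  (forall z, H y1 + 2^-1 * inner (M (y1 - w)) (y1 - w) <=
             H z + 2^-1 * inner (M (z - w)) (z - w)) ->
  forall z, H y1 + inner (M (w - y1)) (z - y1) <= H z.
Proof.
move=> DH Ms ymin z; rewrite -subr_le0.
apply: (@le0_of_le_mul _ _ (2^-1 * inner (M (z - y1)) (z - y1))) => t /andP[t0 t1].
have := ymin (y1 + t *: (z - y1)).
have := affine_sup_convex DH y1 z (introT andP (conj (ltW t0) t1)).
set v := z - y1; set e := w - y1.
rewrite (_ : y1 - w = - e); last by rewrite opprB.
rewrite (_ : y1 + t *: v - w = t *: v - e); last by rewrite /e opprB addrCA addrA.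
clearbody v e.
rewrite !linearD/= !linearN/= !linearZ/= !innerDl !innerDr !innerNl !innerNr !innerZl !innerZr.
rewrite (_ : inner (M v) e = inner (M e) v :> R); last by rewrite Ms innerC.
move=> h1 h2; rewrite -(ler_pM2l t0); lra.
Qed.

End affine_families.

Section conjugate.
Context {R : realType} {X Y : euclideanType R}.

(** The affine functions [inner y u - h u] of [y], whose supremum is [h^*]: they are minorants of
    [h^*], not of [h]. Points with [h u = +oo] would contribute [-oo] and are left out. *)
Definition affine_minorants (h : Y -> \bar R) : set (Y * R) :=
  [set (u, - fine (h u)) | u in [set u | (h u < +oo)%E]].

Lemma affine_sup_conjugate (h : Y -> \bar R) : (forall u, -oo < h u)%E ->
  (forall y, conjugate h y \is a fin_num) ->
  affine_sup (affine_minorants h) (fine \o conjugate h).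
Proof.
move=> hh cf y m; split => [ym _ [u /= hu <-]/=|ym].
  apply: le_trans ym; rewrite -lee_fin fineK//.
  apply: ereal_sup_ubound; exists u => //=.
  have : h u \is a fin_num by rewrite fin_numE gt_eqF// lt_eqF.
  by move/fineK => <-.
rewrite -lee_fin fineK//; apply: ge_ereal_sup => _ [u _ <-].
have [hu|/negPf hu] := boolP (h u < +oo)%E; last first.
  suff -> : h u = +oo%E by rewrite leNye.
  by apply/eqP; rewrite -leye_eq leNgt hu.
have hf : h u \is a fin_num by rewrite fin_numE gt_eqF// lt_eqF.
have := ym (u, - fine (h u)) (ex_intro2 _ _ u hu erefl).
by rewrite -[h u]fineK//= -EFinN -EFinD lee_fin.
Qed.

(** If [h] were [+oo] everywhere, its epigraph and the convex hull of that would be empty, and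
    [convex_hull_fun h] would be [+oo] everywhere. *)
Lemma convex_hull_dom (h : Y -> \bar R) : proper_fun (convex_hull_fun h) ->
  exists u, (h u < +oo)%E.
Proof.
case=> -[u hu] _; apply: contrapT => /forallNP hN.
suff e0 : epigraph h = set0.
  move: hu; rewrite /convex_hull_fun e0.
  rewrite (_ : [set _ | _ in _] = set0) ?ereal_inf0// -subset0 => _ [m /= /(_ set0) sm _].
  by apply: sm; split => //; move=> ? ? ?; rewrite inE.
rewrite -subset0 => -[v m] /= vm; apply: (hN v).
exact: le_lt_trans vm (ltry _).
Qed.

(** A point of the domain of [h] keeps [h^*] above [-oo], and [h^* y = +oo] would make [Ls] equal to
    [-oo] at [y], against (B2). From here on [h^*] can be replaced by a real-valued [H]. *)
Lemma conjugate_fin_num (f : X -> R) (A : 'Hom(X, Y)) (h : Y -> \bar R) (y : Y) :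
  (forall u, -oo < h u)%E -> proper_fun (convex_hull_fun h) ->
  (-oo < ereal_inf [set Ls f A h x y | x in setT])%E ->
  conjugate h y \is a fin_num.
Proof.
move=> hh /convex_hull_dom[u hu] Linf.
rewrite fin_numE; apply/andP; split.
  have hf : h u \is a fin_num by rewrite fin_numE gt_eqF// lt_eqF.
  rewrite gt_eqF//; apply: (@lt_le_trans _ _ ((inner y u)%:E - h u)%E).
    by rewrite -[h u]fineK// -EFinN -EFinD ltNyr.
  by apply: ereal_sup_ubound; exists u.
apply/eqP => cy; move: Linf; apply/negP; rewrite -leNgt.
apply: ge_ereal_inf; exists (Ls f A h 0 y); first by exists 0.
by rewrite /Ls cy/=.
Qed.

(** The negative of [inf_x Ls] is a supremum of affine functions, with slopes [a.1 - A x] and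
    constants [a.2 - f x]. It is finite at each [y], hence bounded above on balls by
    [affine_family_bounded]. *)
Lemma Ls_lower_bound (f : X -> R) (A : 'Hom(X, Y)) (D : set (Y * R)) (H : Y -> R) :
  affine_sup D H ->
  (forall y, exists m, forall x, m <= f x + inner y (A x) - H y) ->
  forall r, exists m, forall x y, `|y| <= r -> m <= f x + inner y (A x) - H y.
Proof.
move=> DH hm r.
pose D' : set (Y * R) := [set p | exists x a, D a /\ p = (a.1 - A x, a.2 - f x)].
have [|m hm'] := @affine_family_bounded _ _ D' _ r.
  move=> y; have [m my] := hm y; exists (- m) => _ [x [a [Da ->]]] /=.
  rewrite innerBr; have := my x; have := affine_sup_ge y DH Da; lra.
exists (- m) => x y yr; rewrite lerBrDr addrC -lerBrDr opprK; apply/DH => a Da.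
have := hm' y (a.1 - A x, a.2 - f x) yr (ex_intro _ x (ex_intro _ a (conj Da erefl))).
by rewrite /= innerBr; lra.
Qed.

End conjugate.

(** * Energy inequality along one trajectory *)

Lemma adjoint_inj {R : realType} {X Y : euclideanType R} (A : 'Hom(X, Y)) y :
  (forall u, exists x, A x = u) -> adjoint A y = 0 -> y = 0.
Proof.
move=> sA Ay; apply: (@inner_eq R) => u; have [x <-] := sA u.
by rewrite innerC adjointP Ay inner0r inner0l.
Qed.

(* The subgradient of [conjugate h] provided by the proximal step, rewritten
   with the primal update of the next iteration. *)
Lemma sppdg_subgradient {T : Type} {R : realType} {X Y : euclideanType R}
    (alpha : R) (A : 'Hom(X, Y)) (h : Y -> \bar R) (D : set (Y * R)) (H : Y -> R)
    x0 y0 (g x : nat -> T -> X) (y : nat -> T -> Y) w :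
  0 < alpha -> (forall u, exists x, A x = u) ->
  (forall y, conjugate h y = (H y)%:E) -> affine_sup D H ->
  is_sppdg alpha A h x0 y0 g x y ->
  forall k z, H (y k.+1 w) +
    inner (A (x k.+2 w + alpha *: (g k.+1 w - g k w))) (z - y k.+1 w) <= H z.
Proof.
move=> a0 sA HE DH [_ _ xS yS] k z.
have := yS k w; cbv zeta; set M := (alpha *: _)%R; set v := (_ + _) => pr.
have ME u : M u = alpha *: A (adjoint A u) by rewrite /M scale_lfunE comp_lfunE.
have Msym u1 u2 : inner (M u1) u2 = inner u1 (M u2) :> R.
  rewrite !ME innerZl innerZr adjointP; congr (_ * _).
  by rewrite [RHS]innerC (adjointP A) innerC.
(* [M u = 0] gives [|A^T u|^2 = 0], and [A^T] is injective because [A] is onto; so [M^-1] is a true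
   inverse. *)
have Minj : lker M == 0%VS.
  apply/lker0P => u1 u2 /eqP; rewrite -subr_eq0 -linearB/= ME scaler_eq0 gt_eqF//=.
  move=> /eqP AA; apply/eqP; rewrite -subr_eq0; apply/eqP/(adjoint_inj sA)/eqP.
  by rewrite -normr_eq0 -sqrf_eq0 -inner_norm -(adjointP A) AA inner0l.
have {}pr z' : H (y k.+1 w) + 2^-1 * inner (M (y k.+1 w - v)) (y k.+1 w - v) <=
             H z' + 2^-1 * inner (M (z' - v)) (z' - v).
  by have := pr z'; rewrite !HE -!EFinD lee_fin.
have := argmin_prox_subgradient DH Msym pr z.
congr (_ + inner _ _ <= _).
rewrite /v addrAC linearD/= lker0_lfunVK// ME -[alpha *: _]linearZ/= -linearD/=.
congr (A _).
(* Two consecutive primal updates eliminate the adjoint terms of [y k] and [y k.+1]. *)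
have Ay j : alpha *: adjoint A (y j w) = x j w - x j.+1 w - alpha *: g j w.
  by rewrite xS; apply: (@inner_eq R) => u; rewrite !(innerDl, innerNl, innerZl); ring.
rewrite linearB/= scalerBr !Ay; apply: (@inner_eq R) => u.
by rewrite !(innerDl, innerNl, innerZl); ring.
Qed.

Section path.
Context {R : realType} {X Y : euclideanType R}.
Variables (alpha L : R) (f : X -> R) (A : 'Hom(X, Y)) (H : Y -> R).
Variables (g x : nat -> X) (y : nat -> Y).
Hypothesis a0 : 0 < alpha.
Hypothesis df : forall a, differentiable f a.
Hypothesis lip : forall a b, `|grad f a - grad f b| <= L * `|a - b|.
Hypothesis xS : forall k, x k.+1 = x k - alpha *: (g k + adjoint A (y k)).
Hypothesis subH : forall k z, H (y k.+1) +
  inner (A (x k.+2 + alpha *: (g k.+1 - g k))) (z - y k.+1) <= H z.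

Let Lr u v : R := f u + inner v (A u) - H v.
Let dx k : R := `|x k - x k.-1| ^+ 2.
Let er k : R := `|g k - grad f (x k)| ^+ 2.

Let sqr_le_add3 (p q u v : R) : 0 <= p -> p <= q + u + v ->
  p ^+ 2 <= 3 * (q ^+ 2 + u ^+ 2 + v ^+ 2).
Proof.
move=> p0 pq; apply: (@le_trans _ _ ((q + u + v) ^+ 2)).
  by rewrite ler_sqr ?nnegrE// (le_trans p0).
by have := sqr_ge0 (q - u); have := sqr_ge0 (q - v); have := sqr_ge0 (u - v); lra.
Qed.

Let add_sub4 (p q u v : X) : p - q = (p - u) - (q - v) + (u - v).
Proof. by apply: (@inner_eq R) => w; rewrite !(innerDl, innerNl); ring. Qed.

Let dual_step (p q s1 s2 G1 G2 : X) :
  alpha *: ((- (alpha^-1 *: p) - s2) - (- (alpha^-1 *: q) - s1)) =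
  (q - alpha *: (G2 - G1) - p) - (alpha *: (s2 - G2) - alpha *: (s1 - G1)).
Proof.
apply: (@inner_eq R) => w; rewrite !(innerZl, innerDl, innerNl).
by field; rewrite gt_eqF.
Qed.

Let sqnormB_scale (p q : X) :
  `|alpha *: p - alpha *: q| ^+ 2 <= 2 * (alpha ^+ 2 * (`|p| ^+ 2 + `|q| ^+ 2)).
Proof.
apply: le_trans (sqnormB_le _ _) _.
by rewrite !normrZ !exprMn -mulrDr real_normK ?num_real.
Qed.

Let energy_arith (f2 f3 i1 i2 i3 H1 H2 ai d1 D3 ed gw c E2 w v S1 S2 : R) :
  f3 + i3 <= f2 + i2 - (ai - L / 2) * D3 - ed ->
  i2 - H2 <= i1 - H1 - gw ->
  - ed <= d1 / 2 * D3 + c * E2 -> - gw <= w + v -> w <= S1 -> v <= S2 ->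
  f3 + i3 - H2 <= f2 + i1 - H1 - (ai - (d1 + L) / 2) * D3 + c * E2 + S1 + S2.
Proof. by lra. Qed.

(** The descent lemma with the primal update controls the move to [x j.+3]; the subgradient at
    [y j.+1] controls the move to [y j.+2]. Young's inequality, with weights [d1] and [d2 / alpha],
    splits the two cross terms: one contains the gradient error, the other the variation of [g]. *)
Lemma energy_step (d1 d2 : R) j : 0 < d1 -> 0 < d2 ->
  Lr (x j.+3) (y j.+2) <= Lr (x j.+2) (y j.+1)
    - (alpha^-1 - (d1 + L) / 2) * dx j.+3 + (2 * d1)^-1 * er j.+2
    + 2 * d2 / alpha * ((1 + alpha * L) ^+ 2 * dx j.+2 + dx j.+3
                        + alpha ^+ 2 * (er j.+2 + er j.+1))
    + 3 * alpha / (2 * d2) * (er j.+1 + er j + L ^+ 2 * dx j.+1).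
Proof.
move=> d10 d20.
pose G k := grad f (x k); pose e k := g k - G k.
pose d k := x k - x k.-1.
have Ay k : adjoint A (y k) = - (alpha^-1 *: d k.+1) - g k.
  rewrite /d/= xS; apply: (@inner_eq R) => u; rewrite !(innerDl, innerNl, innerZl).
  by field; rewrite gt_eqF.
have yA k u : inner (y k) (A u) = inner (adjoint A (y k)) u :> R.
  by rewrite innerC (adjointP A) innerC.
pose gam := g j.+1 - g j.
pose W := alpha *: adjoint A (y j.+2 - y j.+1).
have primal : f (x j.+3) + inner (y j.+2) (A (x j.+3)) <=
    f (x j.+2) + inner (y j.+2) (A (x j.+2)) - (alpha^-1 - L / 2) * dx j.+3
    - inner (e j.+2) (d j.+3).
  have := descent_lemma df lip (x j.+2) (x j.+3).
  have : inner (y j.+2) (A (x j.+3)) = inner (y j.+2) (A (x j.+2))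
      - alpha^-1 * dx j.+3 - inner (g j.+2) (d j.+3) :> R.
    have -> : x j.+3 = x j.+2 + d j.+3 by rewrite addrC subrK.
    rewrite linearD/= innerDr -[RHS]addrA; congr (_ + _).
    by rewrite yA Ay innerBl innerNl innerZl inner_norm.
  rewrite /e innerBl -/(G _) -/(d j.+3); rewrite -/(dx j.+3); lra.
have dual : inner (y j.+2) (A (x j.+2)) - H (y j.+2) <=
    inner (y j.+1) (A (x j.+2)) - H (y j.+1) - inner gam W.
  have := subH j (y j.+2); rewrite adjointP innerDl innerZl -/gam.
  rewrite -(adjointP A (x j.+2)) innerBr ![inner (A _) (y _)]innerC /W innerZr.
  lra.
have young1 : - inner (e j.+2) (d j.+3) <= d1 / 2 * dx j.+3 + (2 * d1)^-1 * er j.+2.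
  rewrite -innerNl innerC; have := inner_young (d j.+3) (- e j.+2) d10.
  by rewrite normrN.
have young2 : - inner gam W <= d2 / alpha / 2 * `|W| ^+ 2 + (2 * (d2 / alpha))^-1 * `|gam| ^+ 2.
  rewrite -innerNl innerC; have := inner_young W (- gam) (divr_gt0 d20 a0).
  by rewrite normrN.
have nG k : `|G k.+1 - G k| <= L * `|d k.+1| by exact: lip.
have gamle : `|gam| ^+ 2 <= 3 * (er j.+1 + er j + L ^+ 2 * dx j.+1).
  have : `|gam| <= `|e j.+1| + `|e j| + L * `|d j.+1|.
    rewrite /gam (add_sub4 _ _ (G j.+1) (G j)).
    by rewrite (le_trans (ler_normD _ _))// lerD// ler_normB.
  move=> /(sqr_le_add3 (normr_ge0 _)).
  by rewrite exprMn.
have Wle : `|W| ^+ 2 <=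
    4 * ((1 + alpha * L) ^+ 2 * dx j.+2 + dx j.+3 + alpha ^+ 2 * (er j.+2 + er j.+1)).
  (* [p] merges a step with the gradient variation that this step dominates, whence
     [(1 + alpha * L) ^+ 2]. *)
  pose p := d j.+2 - alpha *: (G j.+2 - G j.+1).
  have pn : `|p| <= (1 + alpha * L) * `|d j.+2|.
    rewrite (le_trans (ler_normB _ _))// mulrDl mul1r lerD2l normrZ gtr0_norm//.
    by rewrite -mulrA ler_pM2l.
  have -> : W = (p - d j.+3) - (alpha *: e j.+2 - alpha *: e j.+1).
    by rewrite /W linearB/= !Ay (dual_step _ _ _ _ (G j.+1) (G j.+2)).
  have q2 : `|p| ^+ 2 <= (1 + alpha * L) ^+ 2 * dx j.+2.
    by rewrite -exprMn ler_sqr ?nnegrE// (le_trans _ pn).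
  have q1 := sqnormB_le (p - d j.+3) (alpha *: e j.+2 - alpha *: e j.+1).
  apply: (le_trans q1); rewrite -[4]/(2 * 2)%:R natrM -mulrA ler_pM2l// mulrDr.
  apply: lerD.
    by apply: (le_trans (sqnormB_le _ _)); rewrite ler_pM2l// lerD2r.
  exact: sqnormB_scale.
have c1 : 0 <= d2 / alpha / 2 by rewrite !divr_ge0// ltW.
have c2 : 0 <= (2 * (d2 / alpha))^-1 by rewrite invr_ge0 mulr_ge0// divr_ge0// ltW.
have := ler_wpM2l c1 Wle; have := ler_wpM2l c2 gamle.
rewrite (mulrA (_^-1) 3) (mulrA (_ / 2) 4).
rewrite (_ : (2 * (d2 / alpha))^-1 * 3 = 3 * alpha / (2 * d2)); last first.
  by field; rewrite !gt_eqF.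
rewrite (_ : d2 / alpha / 2 * 4 = 2 * d2 / alpha); last by field; rewrite !gt_eqF.
move=> h2 h1; exact: energy_arith primal dual young1 young2 h1 h2.
Qed.

End path.

(** * Limits of a trajectory with summable steps and errors *)

(** Subtracting the convergent series of [q] makes [u] nonincreasing and keeps it bounded below. *)
Lemma quasi_nonincreasing_cvgn {R : realType} (u q : R^nat) (m B : R) :
  (forall n, 0 <= q n) -> (forall n, series q n <= B) ->
  (forall n, u n.+1 <= u n + q n) -> (forall n, m <= u n) -> cvgn u.
Proof.
move=> q0 qB uq mu.
have cq : cvgn (series q).
  apply: nondecreasing_is_cvgn; first by apply/nondecreasing_series => n _ _; exact: q0.
  by exists B => _ [n _ <-].
have cw : cvgn (u - series q).
  apply: nonincreasing_is_cvgn.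
    apply/nonincreasing_seqP => n; rewrite !fctE seriesSr/= opprD addrA -subr_ge0.
    by have := uq n; lra.
  by exists (m - B) => _ [n _ <-]; rewrite !fctE lerB.
by rewrite -[u](subrK (series q)); exact: is_cvgD.
Qed.

(** An energy step involves four consecutive terms of the summable sequence; each shifted sum is
    part of a longer partial sum. *)
Lemma series_window4_le {R : realType} (a : R^nat) (c B : R) n : 0 <= c ->
  (forall k, 0 <= a k) -> (forall n, \sum_(k < n) a k <= B) ->
  series (fun k => c * (a k + a k.+1 + (a k.+2 + a k.+3))) n <=
  c * (B + B + (B + B)).
Proof.
move=> c0 a_ge0 sumB.
have aB k : \sum_(0 <= j < n) a (j + k)%N <= B.
  apply: le_trans (sumB (n + k)); rewrite -(big_mkord xpredT a).
  rewrite [leRHS](@big_cat_nat _ _ _ k)//= ?leq_addl//.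
  have /= := big_addn 0 (n + k) k xpredT a; rewrite add0n addnK => ->.
  by rewrite lerDr sumr_ge0.
rewrite /series/= -mulr_sumr; apply: ler_wpM2l => //; rewrite !big_split/=.
apply: lerD; apply: lerD.
- by rewrite (eq_bigr (fun j => a (j + 0)%N)) => [|j _]; [exact: aB|rewrite addn0].
- by rewrite (eq_bigr (fun j => a (j + 1)%N)) => [|j _]; [exact: aB|rewrite addn1].
- by rewrite (eq_bigr (fun j => a (j + 2)%N)) => [|j _]; [exact: aB|rewrite addn2].
- by rewrite (eq_bigr (fun j => a (j + 3)%N)) => [|j _]; [exact: aB|rewrite addn3].
Qed.

Lemma cvg_ext {V : topologicalType} (u v : nat -> V) (l : V) :
  (forall n, u n = v n) -> u @ \oo --> l -> v @ \oo --> l.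
Proof. by move=> /funext ->. Qed.

(** Successor indices are used because the subgradient inequality is available from [y 1] on. *)
Lemma cluster_subsequence {R : realType} {V : normedModType R} (z : nat -> V) p :
  cluster (z @ \oo) p ->
  exists2 s : nat -> nat, s @ \oo --> \oo & (fun n => z (s n).+1) @ \oo --> p.
Proof.
move=> zp.
have /choice[s hs] (n : nat) : exists k, (n <= k)%N /\ `|p - z k.+1| < n.+1%:R^-1.
  have [||_ [[k + <-]] zb] := zp (z @` [set k | (n.+1 <= k)%N]) (ball p (n.+1%:R^-1 : R)).
  - by exists n.+1 => // k nk; exists k.
  - by apply: nbhsx_ballx; rewrite invr_gt0.
  - case: k zb => // k zb nk; exists k; split => //.
    by move: zb; rewrite -ball_normE.
exists s.
  by move=> A [n _ nA]; exists n => // m /= nm; apply: nA => /=; exact: leq_trans (hs m).1.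
apply/cvgrPdist_lt => e e0.
have := near_infty_natSinv_lt (PosNum e0); apply: filterS => n /=.
exact: lt_trans (hs n).2.
Qed.

(** * Cluster points of a bounded sequence *)

Section bounded_sequences.
Context {R : realType} {X Y : euclideanType R}.
Variables (z : nat -> X * Y) (r : R).
Hypothesis zr : forall k, `|z k| <= r.
Let C := cluster_points z.

Let K : set (X * Y) := [set p | `|p| <= r].

Let K_compact : compact K.
Proof.
rewrite (_ : K = [set u : X | `|u| <= r] `*` [set v : Y | `|v| <= r]).
  by apply: compact_setX; exact: euclidean_ball_compact.
apply/seteqP; split => -[u v]; rewrite /K/= prod_normE/= ge_max.
  by move/andP.
by move=> [-> ->].
Qed.

Let K_closed : closed K.
Proof.
by apply: compact_closed => //; exact: norm_hausdorff.
Qed.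

Lemma cluster_points_compact : C !=set0 /\ compact C.
Proof.
have Kz : (z @ \oo) K by exists 0%N => // k _; exact: zr.
split; first by have [p [_ Cp]] := K_compact _ Kz; exists p.
apply: (subclosed_compact _ K_compact).
  rewrite /C/cluster_points clusterE.
  by apply: closed_bigI => ? _; exact: closed_closure.
rewrite /C/cluster_points clusterE => p /(_ _ Kz).
by rewrite -(closure_id _).1.
Qed.

(** By covering compactness of the ball: around a cluster point take the ball of radius [e], around
    any other point a neighbourhood that the tail of the sequence avoids. *)
Lemma near_cluster_points e : 0 < e ->
  \forall k \near \oo, exists2 c, C c & `|z k - c| < e.
Proof.
move=> e0.
have : \forall k \near \oo, K `<=` [set q | z k = q -> exists2 c, C c & `|q - c| < e].
  apply: ((compact_near_coveringP K).1 K_compact nat \oo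
    (fun k q => z k = q -> exists2 c, C c & `|q - c| < e)) => q Kq.
  have [Cq|nCq] := pselect (C q).
    exists (ball q e, setT); first by split; [exact: nbhsx_ballx|exact: filterT].
    move=> [q' k] [/= + _] _; rewrite -ball_normE/= => qe.
    by exists q => //; rewrite distrC.
  have /existsNP[U /existsNP[V /not_implyP[FU /not_implyP[qV UV0]]]] : ~ cluster (z @ \oo) q by [].
  exists (V, z @^-1` U); first by split.
  move=> [q' k] [/= Vq' Uk] zq; exfalso; apply: UV0.
  by exists q'; rewrite -zq; split => //; rewrite zq.
by apply: filterS => k /(_ _ (zr k)) /(_ erefl).
Qed.

Lemma dist_set_cluster_points_cvg :
  dist_set (z k) C @[k --> \oo] --> (0 : R).
Proof.
(* Half of [e] in the maximum norm: the Euclidean distance is then at most [sqrt 2 * e / 2 < e]. *)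
apply/cvgrPdist_lt => e e0; have e20 : 0 < e / 2 by rewrite divr_gt0.
apply: filterS (near_cluster_points e20) => k [c Cc zc].
have lb : has_lbound [set Num.sqrt (`|(z k).1 - c.1| ^+ 2 + `|(z k).2 - c.2| ^+ 2) | c in C].
  by exists 0 => _ [? _ <-]; exact: sqrtr_ge0.
have d0 : 0 <= dist_set (z k) C.
  apply: lb_le_inf => [|_ [? _ <-]]; last exact: sqrtr_ge0.
  by exists (Num.sqrt (`|(z k).1 - c.1| ^+ 2 + `|(z k).2 - c.2| ^+ 2)), c.
rewrite sub0r normrN ger0_norm//.
apply: (@le_lt_trans _ _ (Num.sqrt (`|(z k).1 - c.1| ^+ 2 + `|(z k).2 - c.2| ^+ 2))).
  by apply: ge_inf => //; exists c.
move: zc; rewrite prod_normE/= gt_max => /andP[z1 z2].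
rewrite -[ltRHS]ger0_norm ?(ltW e0)// -sqrtr_sqr ltr_sqrt ?exprn_gt0//.
have : `|(z k).1 - c.1| ^+ 2 < (e / 2) ^+ 2 by rewrite ltr_sqr ?nnegrE// ltW.
have : `|(z k).2 - c.2| ^+ 2 < (e / 2) ^+ 2 by rewrite ltr_sqr ?nnegrE// ltW.
have : 0 < e ^+ 2 by rewrite exprn_gt0.
rewrite exprMn exprVn; lra.
Qed.

End bounded_sequences.

Section path_limits.
Context {R : realType} {X Y : euclideanType R}.
Variables (alpha L r B : R) (f : X -> R) (A : 'Hom(X, Y)) (h : Y -> \bar R).
Variables (D : set (Y * R)) (H : Y -> R).
Variables (g x : nat -> X) (y : nat -> Y).
Hypotheses (a0 : 0 < alpha) (L0 : 0 < L).
Hypothesis df : forall a, differentiable f a.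
Hypothesis lip : forall a b, `|grad f a - grad f b| <= L * `|a - b|.
Hypothesis xS : forall k, x k.+1 = x k - alpha *: (g k + adjoint A (y k)).
Hypothesis subH : forall k z, H (y k.+1) +
  inner (A (x k.+2 + alpha *: (g k.+1 - g k))) (z - y k.+1) <= H z.
Hypothesis HE : forall y, conjugate h y = (H y)%:E.
Hypothesis DH : affine_sup D H.
Hypothesis lbH : forall y, exists m, forall x, m <= f x + inner y (A x) - H y.
Hypothesis zr : forall k, `|(x k, y k)| <= r.
Hypothesis sumB : forall n, \sum_(k < n)
  (`|x k.+1 - x k| ^+ 2 + `|g k.+1 - grad f (x k.+1)| ^+ 2) <= B.

Let a k : R := `|x k.+1 - x k| ^+ 2 + `|g k.+1 - grad f (x k.+1)| ^+ 2.

Let a_ge0 k : 0 <= a k. Proof. by rewrite addr_ge0// sqr_ge0. Qed.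

Let a_cvg0 : a @ \oo --> (0 : R).
Proof.
apply: cvg_series_cvg_0; apply: nondecreasing_is_cvgn.
  by apply/nondecreasing_series => n _ _.
by exists B => _ [n _ <-]; rewrite /series/= big_mkord.
Qed.

Let sqnorm_cvg0 (V : normedModType R) (u : nat -> V) :
  (forall k, `|u k| ^+ 2 <= a k) -> u @ \oo --> (0 : V).
Proof.
move=> ua; apply/norm_cvg0P.
have s0 : Num.sqrt (a k) @[k --> \oo] --> (0 : R).
  rewrite -(sqrtr0 R); apply: continuous_cvg => //; exact: sqrt_continuous.
apply: (squeeze_cvgr _ (cvg_cst (0 : R)) s0); apply: nearW => k.
by rewrite normr_ge0/= -[leLHS]ger0_norm// -sqrtr_sqr ler_wsqrtr.
Qed.

Let step_cvg0 : x k.+1 - x k @[k --> \oo] --> (0 : X).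
Proof. by apply: sqnorm_cvg0 => k; rewrite lerDl sqr_ge0. Qed.

Let error_cvg0 : g k.+1 - grad f (x k.+1) @[k --> \oo] --> (0 : X).
Proof. by apply: sqnorm_cvg0 => k; rewrite lerDr sqr_ge0. Qed.

Let energy k : R := f (x k.+2) + inner (y k.+1) (A (x k.+2)) - H (y k.+1).

Let energy_arith (E3 E2 ai u p q l k1 k2 d1 d2 d3 e0 e1 e2 S : R) :
  0 <= ai -> 0 <= u -> 0 <= p -> 0 <= q -> 0 <= l -> 0 <= k1 -> 0 <= k2 ->
  0 <= d1 -> 0 <= d2 -> 0 <= d3 -> 0 <= e0 -> 0 <= e1 -> 0 <= e2 ->
  S = (d1 + e0) + (d2 + e1) + (d3 + e2) ->
  E3 <= E2 - (ai - u) * d3 + (2 * 1)^-1 * e2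
    + k1 * (p * d2 + d3 + q * (e2 + e1)) + k2 * (e1 + e0 + l * d1) ->
  E3 <= E2 + (u + (2 * 1)^-1 + k1 * (p + 1 + q) + k2 * (1 + l)) * S.
Proof.
move=> ai0 u0 p0 q0 l0 k10 k20 d10 d20 d30 e00 e10 e20 SE.
have dS : u * d3 <= u * S by apply: ler_wpM2l => //; lra.
have k1S : k1 * (p * d2 + d3 + q * (e2 + e1)) <= k1 * ((p + 1 + q) * S).
  apply: ler_wpM2l => //; rewrite !mulrDl mul1r !lerD//; last 1 first.
  - by apply: ler_wpM2l => //; lra.
  - by apply: ler_wpM2l => //; lra.
  - by lra.
have k2S : k2 * (e1 + e0 + l * d1) <= k2 * ((1 + l) * S).
  apply: ler_wpM2l => //; rewrite mulrDl mul1r lerD//; first by lra.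
  by apply: ler_wpM2l => //; lra.
have := mulr_ge0 ai0 d30; lra.
Qed.

Let regroup (d0 d1 d2 d3 e0 e1 e2 e3 : R) : 0 <= d0 -> 0 <= e3 ->
  (d1 + e0) + (d2 + e1) + (d3 + e2) <=
  (d0 + e0) + (d1 + e1) + ((d2 + e2) + (d3 + e3)).
Proof. by lra. Qed.

(** Steps and errors are summable already, so the sign of the quadratic form is immaterial and
    [energy_step] is used with both parameters equal to 1. The energy then grows by at most [c]
    times four terms of [a]. *)
Let energy_cvg : exists l : R, energy @ \oo --> l.
Proof.
have aw := ltW a0; have Lw := ltW L0; have [m mL] := Ls_lower_bound DH lbH r.
pose c : R := (1 + L) / 2 + (2 * 1)^-1 +
  2 * 1 / alpha * ((1 + alpha * L) ^+ 2 + 1 + alpha ^+ 2) + 3 * alpha / (2 * 1) * (1 + L ^+ 2).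
have c0 : 0 <= c.
  by rewrite /c; do !(apply: addr_ge0 || apply: mulr_ge0 || apply: divr_ge0
    || apply: sqr_ge0 || rewrite invr_ge0) => //.
(* The first step is skipped because [a] contains no error of index 0. *)
suff : cvgn (fun n => energy n.+1) by move=> /cvg_ex[l El]; exists l; rewrite -cvg_shiftS.
apply: (@quasi_nonincreasing_cvgn _ _
  (fun k => c * (a k + a k.+1 + (a k.+2 + a k.+3))) m (c * (B + B + (B + B)))).
- by move=> n; rewrite mulr_ge0// !addr_ge0.
- by move=> n; apply: series_window4_le.
- move=> n; have := energy_step a0 df lip xS subH n.+1 ltr01 ltr01.
  move=> /(energy_arith _ _ _ _ _ _ _ _ _ _ _ _ _ erefl).
  move=> H1; apply: le_trans (H1 _ _ _ _ _ _ _ _ _ _ _ _ _) _.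
  all: try by [exact: sqr_ge0|rewrite ?invr_ge0;
    do ?[apply: sqr_ge0|apply: divr_ge0|apply: mulr_ge0|apply: addr_ge0]].
  rewrite /energy lerD2l; apply: ler_wpM2l; first exact: c0.
  by apply: regroup; exact: sqr_ge0.
- move=> n; apply: mL; have := zr n.+2.
  by rewrite prod_normE/= ge_max => /andP[].
Qed.

Lemma path_cluster_points :
  [/\ cluster_points (fun k => (x k, y k)) `<=` crit_Ls f A h &
     exists c : R, forall z, cluster_points (fun k => (x k, y k)) z ->
       Ls f A h z.1 z.2 = c%:E].
Proof.
have [l El] := energy_cvg.
(* The limit [l] of the energy does not depend on the cluster point, which gives constancy. *)
suff key (p : X * Y) : cluster_points (fun k => (x k, y k)) p ->
    [/\ grad f p.1 + adjoint A p.2 = 0,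
       forall z, H p.2 + inner (A p.1) (z - p.2) <= H z &
       f p.1 + inner p.2 (A p.1) - H p.2 = l].
  split=> [p /key[p1 p2 p3]|].
    rewrite /crit_Ls/= /subdiff_Ls/=; split => /=; first by rewrite p1.
    exists (A p.1); last by rewrite subrr.
    split; first by rewrite HE.
    by move=> z; rewrite !HE -EFinD lee_fin.
  by exists l => p /key[_ _ <-]; rewrite /Ls HE -EFinB.
move=> /cluster_subsequence[s soo zs].
have gradc : continuous (grad f).
  move=> u; apply/cvgrPdist_lt => e e0.
  have eL : 0 < e / L by rewrite divr_gt0.
  apply/nbhs_ballP; exists (e / L) => //= v; rewrite -ball_normE/= => uv.
  by rewrite (le_lt_trans (lip _ _))// mulrC -ltr_pdivlMr.
have xs1 : x (s n).+1 @[n --> \oo] --> p.1.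
  by apply: (cvg_comp _ fst zs); exact: cvg_fst.
have ys1 : y (s n).+1 @[n --> \oo] --> p.2.
  by apply: (cvg_comp _ snd zs); exact: cvg_snd.
have st : x (s n).+1 - x (s n) @[n --> \oo] --> (0 : X).
  exact: (cvg_comp _ _ soo step_cvg0).
have st1 : x (s n).+2 - x (s n).+1 @[n --> \oo] --> (0 : X).
  have st' : x n.+2 - x n.+1 @[n --> \oo] --> (0 : X).
    by rewrite (cvg_shiftS (fun n => x n.+1 - x n)).
  exact: (cvg_comp _ _ soo st').
have xs2 : x (s n).+2 @[n --> \oo] --> p.1.
  have := cvgD st1 xs1; rewrite add0r.
  by move=> /(_ _) cv; apply: cvg_ext _ cv => n /=; rewrite subrK.
have xs0 : x (s n) @[n --> \oo] --> p.1.
  have := cvgB xs1 st; rewrite subr0.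
  by move=> /(_ _) cv; apply: cvg_ext _ cv => n /=; rewrite opprB addrC subrK.
have gs1 : g (s n).+1 @[n --> \oo] --> grad f p.1.
  have := cvgD (cvg_comp _ _ soo error_cvg0) (cvg_comp _ _ xs1 (gradc p.1)).
  by rewrite add0r; move=> /(_ _) cv; apply: cvg_ext _ cv => n /=; rewrite subrK.
have gs0 : g (s n) @[n --> \oo] --> grad f p.1.
  have e0 : g k - grad f (x k) @[k --> \oo] --> (0 : X).
    by rewrite -(cvg_shiftS (fun k => g k - grad f (x k))); exact: error_cvg0.
  have := cvgD (cvg_comp _ _ soo e0) (cvg_comp _ _ xs0 (gradc p.1)).
  by rewrite add0r; move=> /(_ _) cv; apply: cvg_ext _ cv => n /=; rewrite subrK.
have fc : f (x (s n).+2) @[n --> \oo] --> (f p.1 : R).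
  exact: (cvg_comp _ _ xs2 (differentiable_continuous (df p.1))).
have Ac u : continuous_at u A by exact: euclidean_linear_continuous.
(* Solve the energy for its [H] term: everything else converges. *)
have Hy : H (y (s n).+1) @[n --> \oo] --> (f p.1 + inner p.2 (A p.1) - l : R).
  have := cvgB (cvgD fc (inner_cvg ys1 (cvg_comp _ _ xs2 (Ac p.1)))) (cvg_comp _ _ soo El).
  by move=> /(_ _ _ _) cv; apply: cvg_ext _ cv => n /=; rewrite /energy opprB addrC subrK.
have sub z : f p.1 + inner p.2 (A p.1) - l + inner (A p.1) (z - p.2) <= H z.
  have sg : inner (A (x (s n).+2 + alpha *: (g (s n).+1 - g (s n)))) (z - y (s n).+1)
      @[n --> \oo] --> (inner (A p.1) (z - p.2) : R).
    apply: inner_cvg; last by apply: cvgB => //; exact: cvg_cst.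
    have pc : x (s n).+2 + alpha *: (g (s n).+1 - g (s n)) @[n --> \oo] -->
        p.1 + alpha *: (grad f p.1 - grad f p.1).
      by apply: cvgD => //; apply: cvgZl_tmp; exact: cvgB.
    by rewrite subrr scaler0 addr0 in pc; exact: (cvg_comp _ _ pc (Ac p.1)).
  apply: (cvgr_to_le (cvgD Hy sg)); apply: nearW => n; exact: subH.
(* Lower semicontinuity gives one inequality, the limiting subgradient inequality at [z = p.2] the
   other. *)
have HyE : H p.2 = f p.1 + inner p.2 (A p.1) - l.
  apply/eqP; rewrite eq_le; apply/andP; split.
    exact: (affine_sup_lsc DH ys1 Hy).
  by have := sub p.2; rewrite subrr inner0r addr0.
split; [|by move=> z; rewrite HyE|by rewrite HyE; lra].
(* The same sequence has a limit by continuity of the adjoint and one by the primal update; their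
   equality is stationarity in [x]. *)
have A1 : adjoint A (y (s n).+1) @[n --> \oo] --> adjoint A p.2.
  exact: (cvg_comp _ _ ys1 (@euclidean_linear_continuous _ _ _ (adjoint A) p.2)).
have A2 : adjoint A (y (s n).+1) @[n --> \oo] --> - (alpha^-1 *: 0) - grad f p.1.
  have := cvgB (cvgN (cvgZl_tmp (k := alpha^-1) st1)) gs1.
  move=> /(_ _ _ _) cv; apply: cvg_ext _ cv => n /=.
  rewrite !fctE /= xS; apply: (@inner_eq R) => u; rewrite !(innerDl, innerNl, innerZl).
  by field; rewrite gt_eqF.
have := cvg_unique _ A1 A2; rewrite scaler0 oppr0 sub0r => ->; first by rewrite addrN.
exact: norm_hausdorff.
Qed.

End path_limits.

(** * Localization to bounded trajectories *)

Section localization.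
Context {R : realType} {X Y : euclideanType R}.
Variables (alpha L r : R) (f : X -> R) (A : 'Hom(X, Y)).
Variables (D : set (Y * R)) (H : Y -> R).
Hypotheses (a0 : 0 < alpha) (L0 : 0 < L).
Hypothesis df : forall a, differentiable f a.
Hypothesis lip : forall a b, `|grad f a - grad f b| <= L * `|a - b|.
Hypothesis DH : affine_sup D H.
Hypothesis lbH : forall y, exists m, forall x, m <= f x + inner y (A x) - H y.

(** The descent lemma from 0 bounds [f], Cauchy-Schwarz the bilinear term, and any single affine
    function of [D] bounds [- H]. *)
Lemma Ls_upper_bound : exists m, forall x y, `|x| <= r -> `|y| <= r ->
  f x + inner y (A x) - H y <= m.
Proof.
have [b Db] : D !=set0.
  apply/set0P/eqP => D0.
  have : H 0 <= H 0 - 1 by apply/DH => b; rewrite D0.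
  by rewrite lerBrDl gerDr ler10.
have [c c0 Ac] := euclidean_linear_bounded A.
pose m := f 0 + `|grad f 0| * r + L / 2 * r ^+ 2 + r * (c * r) + (r * `|b.1| - b.2).
exists m => x y xr yr; have r0 : 0 <= r by exact: le_trans xr.
have fx : f x <= f 0 + `|grad f 0| * r + L / 2 * r ^+ 2.
  apply: (le_trans (descent_lemma df lip 0 x)); rewrite subr0; apply: lerD.
    rewrite lerD2l (le_trans (ler_norm _))// (le_trans (cauchy_schwarz _ _))//.
    by rewrite ler_wpM2l.
  by rewrite ler_wpM2l ?divr_ge0 ?(ltW L0)// ler_sqr ?nnegrE.
have yAx : inner y (A x) <= r * (c * r).
  rewrite (le_trans (ler_norm _))// (le_trans (cauchy_schwarz _ _))//.
  by rewrite ler_pM// (le_trans (Ac x))// ler_wpM2l.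
have Hy : - H y <= r * `|b.1| - b.2.
  have := affine_sup_ge y DH Db.
  have : - inner y b.1 <= r * `|b.1|.
    rewrite -innerNl (le_trans (ler_norm _))// (le_trans (cauchy_schwarz _ _))//.
    by rewrite normrN ler_wpM2r.
  lra.
exact: (lerD (lerD fx yAx) Hy).
Qed.

Let energy_arith (E1 E2 K C S c0 c1 k1 k2 p q l u1 u2 u3 w1 w2 w3 v1 v2 v3 e1 e2 e3 : R) :
  u1 = v1 -> u2 = v2 -> u3 = v3 -> w1 = e1 -> w2 = e2 -> w3 = e3 ->
  E2 <= E1 - c0 * v3 + c1 * e3 + k1 * (p * v2 + v3 + q * (e3 + e2)) +
    k2 * (e2 + e1 + l * v1) ->
  E1 + C <= K + S ->
  E2 + C <= K + (S + (- c0 * u3 + c1 * w3 + k1 * (p * u2 + u3 + q * (w3 + w2)) +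
    k2 * (w2 + w1 + l * u1))).
Proof. by move=> -> -> -> -> -> ->; lra. Qed.

(** After the exit from the ball, the terms whose coefficient may be negative vanish. *)
Let weight_arith (c0 c1 k1 k2 p q l u1 u2 u3 w1 w2 w3 : R) :
  0 <= k1 -> 0 <= k2 -> 0 <= p -> 0 <= q -> 0 <= l ->
  0 <= u1 -> 0 <= u2 -> 0 <= w1 -> 0 <= w2 -> u3 = 0 -> w3 = 0 ->
  0 <= - c0 * u3 + c1 * w3 + k1 * (p * u2 + u3 + q * (w3 + w2)) +
    k2 * (w2 + w1 + l * u1).
Proof.
move=> k10 k20 p0 q0 l0 u10 u20 w10 w20 -> ->.
by rewrite !mulr0 !add0r addr0; do !(apply: addr_ge0 || apply: mulr_ge0).
Qed.

(* The energy is taken at [(x k.+1, y k)]: when [a k] holds it is bounded below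
   whatever [x k.+1] is, so no control on the first step out of the ball is
   needed, and [K] does not depend on the trajectory. *)
Lemma localized_energy (d1 d2 : R) : 0 < d1 -> 0 < d2 -> exists K, 
  forall (g x : nat -> X) (y : nat -> Y) (a : nat -> bool),
  (forall k, x k.+1 = x k - alpha *: (g k + adjoint A (y k))) ->
  (forall k z, H (y k.+1) +
    inner (A (x k.+2 + alpha *: (g k.+1 - g k))) (z - y k.+1) <= H z) ->
  (forall k, a k.+1 -> a k) ->
  (forall k, a k -> `|x k| <= r /\ `|y k| <= r) ->
  let u k := (a k)%:R * `|x k.+1 - x k| ^+ 2 in
  let w k := (a k)%:R * `|g k - grad f (x k)| ^+ 2 in
  forall n, 0 <= K + \sum_(j < n)
    (- (alpha^-1 - (d1 + L) / 2) * u j.+3 + (2 * d1)^-1 * w j.+3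
    + 2 * d2 / alpha * ((1 + alpha * L) ^+ 2 * u j.+2 + u j.+3
                        + alpha ^+ 2 * (w j.+3 + w j.+2))
    + 3 * alpha / (2 * d2) * (w j.+2 + w j.+1 + L ^+ 2 * u j.+1)).
Proof.
move=> d10 d20.
have [C0 C0P] := Ls_lower_bound DH lbH r.
have [K0 K0P] := Ls_upper_bound.
(* Adding [C] makes the energy nonnegative while [|y k| <= r]; [K0 + C] bounds the shifted initial
   energy, and the absolute value covers paths that start outside. *)
pose C := - C0; exists (`|K0 + C|) => g x y a xS subH aS ar u w n.
have k10 : 0 <= 2 * d2 / alpha by rewrite divr_ge0 ?mulr_ge0 ?ltW.
have k20 : 0 <= 3 * alpha / (2 * d2) by rewrite divr_ge0 ?mulr_ge0 ?ltW.
have u0 k : 0 <= u k by rewrite mulr_ge0// sqr_ge0.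
have w0 k : 0 <= w k by rewrite mulr_ge0// sqr_ge0.
have uT k : a k -> u k = `|x k.+1 - x k| ^+ 2 by rewrite /u => ->; rewrite mul1r.
have wT k : a k -> w k = `|g k - grad f (x k)| ^+ 2 by rewrite /w => ->; rewrite mul1r.
have uF k : ~~ a k -> u k = 0 by rewrite /u => /negPf ->; rewrite mul0r.
have wF k : ~~ a k -> w k = 0 by rewrite /w => /negPf ->; rewrite mul0r.
clearbody u w.
pose t j := - (alpha^-1 - (d1 + L) / 2) * u j.+3 + (2 * d1)^-1 * w j.+3
    + 2 * d2 / alpha * ((1 + alpha * L) ^+ 2 * u j.+2 + u j.+3
                        + alpha ^+ 2 * (w j.+3 + w j.+2))
    + 3 * alpha / (2 * d2) * (w j.+2 + w j.+1 + L ^+ 2 * u j.+1).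
(* The induction also carries that the sum dominates the shifted energy while the path is inside.
   Inside, this gives nonnegativity; after the exit each new summand is itself nonnegative. *)
suff [] : 0 <= `|K0 + C| + \sum_(j < n) t j /\
  (a n.+3 -> f (x n.+3) + inner (y n.+2) (A (x n.+3)) - H (y n.+2) + C <=
    `|K0 + C| + \sum_(j < n) t j) by [].
elim: n => [|n [IH0 IH]].
  rewrite big_ord0 addr0; split=> // a3.
  apply: le_trans (ler_norm _); rewrite lerD2r.
  by apply: K0P; [exact: (ar _ a3).1|exact: (ar _ (aS _ a3)).2].
rewrite big_ord_recr/=.
have [a3|na3] := boolP (a n.+3).
  have E := energy_step a0 df lip xS subH n.+1 d10 d20.
  have ub : f (x n.+4) + inner (y n.+3) (A (x n.+4)) - H (y n.+3) + C <=
      `|K0 + C| + (\sum_(j < n) t j + t n).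
    exact: (energy_arith (uT _ (aS _ (aS _ a3))) (uT _ (aS _ a3)) (uT _ a3)
      (wT _ (aS _ (aS _ a3))) (wT _ (aS _ a3)) (wT _ a3) E (IH a3)).
  split=> //; apply: le_trans ub.
  have := C0P (x n.+4) (y n.+3) (ar _ a3).2.
  by rewrite /C subr_ge0.
split; last by move=> /aS; rewrite (negPf na3).
rewrite addrA addr_ge0//; apply: weight_arith; rewrite ?sqr_ge0//.
- exact: uF.
- exact: wF.
Qed.

End localization.

(** * Summability from the variance recursion *)

Lemma sum_shift {V : zmodType} (a : nat -> V) k n :
  \sum_(j < n) a (k + j)%N = \sum_(j < k + n) a j - \sum_(j < k) a j.
Proof. by rewrite big_split_ord/= addrC addrK. Qed.

Section variance_recursion.
Context {R : realType}.
Variables (D V M : R^nat) (s1 sL rho K c0 c1 k1 k2 p q l : R).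
Hypotheses (D0 : forall k, 0 <= D k) (V0 : forall k, 0 <= V k)
  (M0 : forall k, 0 <= M k).
Hypotheses (s10 : 0 <= s1) (sL0 : 0 <= sL) (rho0 : 0 < rho).
Hypotheses (c10 : 0 <= c1) (k10 : 0 <= k1) (k20 : 0 <= k2) (p0 : 0 <= p)
  (q0 : 0 <= q) (l0 : 0 <= l).
Hypothesis VM : forall k, V k.+1 <= M k.+1 + s1 * (D k.+1 + D k).
Hypothesis MM : forall k, M k.+2 <= (1 - rho) * M k.+1 + sL * (D k.+1 + D k).
Hypothesis sumQ : forall n, 0 <= K + \sum_(j < n)
  (- c0 * D j.+3 + c1 * V j.+3 + k1 * (p * D j.+2 + D j.+3 + q * (V j.+3 + V j.+2))
   + k2 * (V j.+2 + V j.+1 + l * D j.+1)).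
Let kappa := s1 + sL / rho.
(** The margin left in [c0] once every other term is charged to the sum of the [D]'s. *)
Let e := c0 - 2 * kappa * c1 - k1 * (p + 1 + 4 * q * kappa) - k2 * (4 * kappa + l).
Hypothesis e_gt0 : 0 < e.

(** Summing the decay of [M] telescopes and bounds [rho] times the sum of the [M]'s; inserted in the
    bound on [V], this produces [kappa], with a factor 2 for the two [D] terms. *)
Let V_sum n : \sum_(j < n) V j.+1 <= M 1 / rho + 2 * kappa * \sum_(j < n.+1) D j.
Proof.
have h1 : \sum_(j < n) V j.+1 <=
    \sum_(j < n) M j.+1 + s1 * (\sum_(j < n.+1) D j + \sum_(j < n) D j).
  elim: n => [|n IH]; first by rewrite !big_ord0 add0r addr0 mulr_ge0// sumr_ge0.
  rewrite !(big_ord_recr n) big_ord_recr/=.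
  have := VM n; move: IH; rewrite (big_ord_recr n)/=.
  move: (\sum_(j < n) V _) (\sum_(j < n) M _) (\sum_(j < n) D _) => a b c.
  lra.
have h2 : rho * (\sum_(j < n) M j.+1) + M n.+1 <=
    M 1 + sL * (\sum_(j < n.+1) D j + \sum_(j < n) D j).
  elim: n {h1} => [|n IH].
    by rewrite !big_ord0 mulr0 add0r addr0 lerDl mulr_ge0// sumr_ge0.
  rewrite !(big_ord_recr n) big_ord_recr/=.
  have := MM n; move: IH; rewrite (big_ord_recr n)/=.
  move: (\sum_(j < n) M _) (\sum_(j < n) D _) => b c.
  lra.
have h3 : \sum_(j < n) D j <= \sum_(j < n.+1) D j by rewrite big_ord_recr/= lerDl.
have h4 : \sum_(j < n) M j.+1 <= M 1 / rho + 2 * (sL / rho) * \sum_(j < n.+1) D j.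
  rewrite (_ : _ + _ = (M 1 + sL * (\sum_(j < n.+1) D j + \sum_(j < n.+1) D j)) / rho); last first.
    by field; rewrite gt_eqF.
  rewrite ler_pdivlMr// mulrC.
  apply: (@le_trans _ _ (M 1 + sL * (\sum_(j < n.+1) D j + \sum_(j < n) D j))).
    by apply: le_trans h2; rewrite lerDl.
  by rewrite lerD2l ler_wpM2l// lerD2l.
have h5 : \sum_(j < n.+1) D j + \sum_(j < n) D j <=
    \sum_(j < n.+1) D j + \sum_(j < n.+1) D j by rewrite lerD2l.
apply: (le_trans h1); apply: (le_trans (lerD h4 (ler_wpM2l s10 h5))).
by rewrite /kappa; lra.
Qed.

Let sum_linear n (a b c d g h : nat -> R) :
  \sum_(j < n) (- c0 * a j + c1 * b j + k1 * (p * c j + a j + q * (b j + d j))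
    + k2 * (d j + g j + l * h j)) =
  - c0 * (\sum_(j < n) a j) + c1 * (\sum_(j < n) b j)
  + k1 * (p * (\sum_(j < n) c j) + \sum_(j < n) a j
          + q * (\sum_(j < n) b j + \sum_(j < n) d j))
  + k2 * (\sum_(j < n) d j + \sum_(j < n) g j + l * (\sum_(j < n) h j)).
Proof.
elim: n => [|n IH]; first by rewrite !big_ord0; ring.
by rewrite !big_ord_recr/= IH; ring.
Qed.

Let absorb (s S3 t W b c d g h : R) :
  0 <= K + (- c0 * (s - S3) + c1 * b + k1 * (p * c + (s - S3) + q * (b + d))
    + k2 * (d + g + l * h)) ->
  b <= t -> d <= t -> g <= t -> c <= s -> h <= s -> t <= W + 2 * kappa * s ->
  0 <= S3 -> e * s <= K + c0 * S3 + (c1 + 2 * (k1 * q) + 2 * k2) * W.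
Proof.
move=> Q bt dt gt cs hs tW S30; set w := W + 2 * kappa * s in tW.
have B1 : c1 * b <= c1 * w by rewrite ler_wpM2l// (le_trans bt).
have B2 : k1 * (p * c + (s - S3) + q * (b + d)) <= k1 * (p * s + s + q * (w + w)).
  apply: ler_wpM2l => //; apply: lerD; first by apply: lerD; [exact: ler_wpM2l|rewrite gerBl].
  by apply: ler_wpM2l => //; apply: lerD; [exact: le_trans bt _|exact: le_trans dt _].
have B3 : k2 * (d + g + l * h) <= k2 * (w + w + l * s).
  apply: ler_wpM2l => //; apply: lerD; last exact: ler_wpM2l.
  by apply: lerD; [exact: le_trans dt _|exact: le_trans gt _].
have : 0 <= K + (- c0 * (s - S3) + c1 * w + k1 * (p * s + s + q * (w + w))
    + k2 * (w + w + l * s)).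
  by apply: (le_trans Q); rewrite lerD2l !lerD.
rewrite /w /e; lra.
Qed.

(** Bounding every shifted sum by [S] or [T], and [T] by [S], turns [sumQ] into [e * S <= K']. The
    part [c0 * S 3] of [K'] stands for the three terms missing from the sum that carries [- c0]. *)
Lemma variance_recursion_summable : exists B, forall n,
  \sum_(j < n) (D j + V j.+1) <= B.
Proof.
pose S n := \sum_(j < n) D j; pose T n := \sum_(j < n) V j.+1.
have TS n : T n <= M 1 / rho + 2 * kappa * S n.+1 by exact: V_sum.
have S0 n : 0 <= S n by rewrite sumr_ge0.
have T0 n : 0 <= T n by rewrite sumr_ge0.
have Smon n : S n <= S n.+1 by rewrite /S big_ord_recr/= lerDl.
have Tmon n : T n <= T n.+1 by rewrite /T big_ord_recr/= lerDl.
have k0 : 0 <= kappa by rewrite addr_ge0// divr_ge0// ltW.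
pose W := M 1 / rho.
pose K' := K + c0 * S 3 + (c1 + 2 * (k1 * q) + 2 * k2) * W.
have SB n : S n.+3 <= K' / e.
  have d3 : \sum_(j < n) D j.+3 = S n.+3 - S 3 by exact: (sum_shift D 3 n).
  have d2 : \sum_(j < n) D j.+2 <= S n.+3.
    have := sum_shift D 2 n; rewrite add2n => ->; rewrite lerBlDr (le_trans (Smon _))//.
    by rewrite lerDl sumr_ge0.
  have d1 : \sum_(j < n) D j.+1 <= S n.+3.
    have := sum_shift D 1 n; rewrite add1n => ->; rewrite lerBlDr.
    by rewrite (le_trans (Smon _))// (le_trans (Smon _))// lerDl sumr_ge0.
  have v1 : \sum_(j < n) V j.+1 <= T n.+2 by rewrite (le_trans (Tmon _)).
  have v2 : \sum_(j < n) V j.+2 <= T n.+2.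
    have := sum_shift (fun j => V j.+1) 1 n; rewrite add1n => ->; rewrite lerBlDr.
    by rewrite (le_trans (Tmon _))// lerDl sumr_ge0.
  have v3 : \sum_(j < n) V j.+3 <= T n.+2.
    have := sum_shift (fun j => V j.+1) 2 n; rewrite add2n => ->.
    by rewrite lerBlDr lerDl sumr_ge0.
  have := sumQ n.
  rewrite (sum_linear n (fun j => D j.+3) (fun j => V j.+3) (fun j => D j.+2)
    (fun j => V j.+2) (fun j => V j.+1) (fun j => D j.+1)) d3 => Q.
  rewrite ler_pdivlMr// mulrC.
  exact: absorb Q v3 v2 v1 d2 d1 (TS n.+2) (S0 3).
exists (K' / e + (W + 2 * kappa * (K' / e))) => n.
rewrite big_split/=; apply: lerD.
  by apply: le_trans (SB n); rewrite (le_trans (Smon _))// (le_trans (Smon _)).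
apply: (le_trans (TS n)); rewrite lerD2l ler_wpM2l ?mulr_ge0//.
by apply: le_trans (SB n); rewrite (le_trans (Smon _)).
Qed.

End variance_recursion.

(** * Conditional expectation *)

Section conditional_expectation.
Context {d : measure_display} {T : measurableType d} {R : realType}.
Variables (P : probability T R) (G : set (set T)).
Hypothesis Gm : <<s G >> `<=` measurable.

(* Radon-Nikodym on the sub-sigma-algebra. *)
Lemma condexpP (Z : T -> R) : P.-integrable setT (EFin \o Z) ->
  is_condexp P <<s G >> Z (condexp P <<s G >> Z).
Proof.
move=> iZ; rewrite /condexp; case: xgetP => [W _ //|noW]; exfalso.
(* The identity seen as a map to the coarser measurable space: pushing [P] and the charge with
   density [Z] along it restricts both to the sub-sigma-algebra. *)
pose idm : T -> (g_sigma_algebraType G) := fun w => w.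
have mid : measurable_fun setT idm by move=> _ B /Gm mB; rewrite setTI.
pose X : {mfun T >-> (g_sigma_algebraType G)} := 
  HB.pack idm (isMeasurableFun.Build _ _ _ _ idm mid).
pose P' := distribution P X.
pose nu : {charge set T -> \bar R} := induced_charge iZ.
pose pnu : {charge set (g_sigma_algebraType G) -> \bar R} := pushforward nu X.
pose nu' := pnu mid.
have dom : nu' `<< P'.
  apply: dominates_pushforward => //.
  apply/null_content_dominatesP => A mA PA0.
  apply: null_set_integral => //.
  exact: (measurable_funS measurableT (@subsetT _ A) (measurable_int P iZ)).
pose f : (g_sigma_algebraType G) -> \bar R := Radon_Nikodym nu' P'.
have fW w : f w \is a fin_num by exact: Radon_Nikodym_fin_num.
have iW : P'.-integrable [set: (g_sigma_algebraType G)] f by exact: Radon_Nikodym_integrable.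
have eW (A : set (g_sigma_algebraType G)) : measurable A -> nu' A = (\int[P']_(x in A) f x)%E.
  exact: Radon_Nikodym_integral.
have mf : @measurable_fun _ _ (g_sigma_algebraType G) (\bar R) setT f by exact: measurable_int iW.
have fE : EFin \o (fine \o f) = f by apply/funext => w /=; rewrite fineK.
have if' : P.-integrable setT (f \o X).
  apply/integrableP; split.
    by apply: (measurableT_comp mf).
  move/integrableP : iW => [_]; apply: le_lt_trans.
  rewrite /P' ge0_integral_distribution//.
  exact: measurableT_comp.
apply: (noW (fine \o f)); split.
- move=> B mB; rewrite -[X in <<s G >> X]setTI.
  have mff : measurable_fun [set: g_sigma_algebraType G] (fine \o f).
    by apply: measurableT_comp => //; exact: fine_measurable.
  exact: (mff measurableT B mB).
- by rewrite fE.
- move=> B GB; have mB : (measurable : set (set (g_sigma_algebraType G))) B by [].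
  transitivity (\int[P]_(w in B) f w)%E; first by apply: eq_integral => w _; rewrite /= fineK.
  transitivity (\int[P']_(w in B) f w)%E.
    rewrite /P' /distribution (@integral_pushforward _ _ T (g_sigma_algebraType G))//.
    by apply: (integrableS measurableT) => //; exact: Gm.
  by rewrite -eW.
Qed.

End conditional_expectation.

(** * Events of the filtration *)

Section histories.
Context {T : pointedType} {d : measure_display} {S : nat -> measurableType d}.
Variable xi : forall j, T -> S j.

Lemma history_le k l : (k <= l)%N -> history xi k `<=` history xi l.
Proof.
move=> kl; apply: sub_sigma_algebra2 => B [j jk jB]; exists j => //.
exact: (leq_trans jk kl).
Qed.

Lemma historyI k B C : history xi k B -> history xi k C -> history xi k (B `&` C).
Proof. exact: (@measurableI _ (g_sigma_algebraType _)). Qed.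

Lemma borel_ball {R : realType} {X : normedModType R} (r : R) :
  borel [set u : X | `|u| <= r].
Proof.
rewrite -[X in borel X]setCK; apply: sigma_algebraC; apply: sub_sigma_algebra.
rewrite /= openC.
exact: closed_norm_le.
Qed.

(** The bound is imposed up to time [k], so that the events decrease in [k]. *)
Definition bounded_event {R : realType} {X Y : normedModType R}
    (x : nat -> T -> X) (y : nat -> T -> Y) (r : R) (k : nat) : set T :=
  [set w | forall j, (j <= k)%N -> `|x j w| <= r /\ `|y j w| <= r].

Lemma bounded_event_history {R : realType} {X Y : normedModType R}
    (x : nat -> T -> X) (y : nat -> T -> Y) r k :
  (forall k, measurable_wrt (history xi k) (@borel X) (x k)) ->
  (forall k, measurable_wrt (history xi k) (@borel Y) (y k)) ->
  history xi k (bounded_event x y r k).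
Proof.
move=> hx hy.
have ball j : history xi j ([set w | `|x j w| <= r] `&` [set w | `|y j w| <= r]).
  by apply: historyI; [exact: hx (borel_ball r)|exact: hy (borel_ball r)].
elim: k => [|k IH].
  rewrite (_ : bounded_event _ _ _ _ = [set w | `|x 0%N w| <= r] `&` [set w | `|y 0%N w| <= r])//.
  by apply/seteqP; split=> w; [move/(_ 0%N); exact|move=> w0 j; rewrite leqn0 => /eqP ->].
rewrite (_ : bounded_event _ _ _ _ = bounded_event x y r k `&`
    ([set w | `|x k.+1 w| <= r] `&` [set w | `|y k.+1 w| <= r])).
  by apply: historyI => //; exact: (history_le (leqnSn k)).
apply/seteqP; split=> w.
  by move=> wk; split; [move=> j jk; apply: wk; exact: leqW|exact: wk].
by move=> [wk wk1] j; rewrite leq_eqVlt => /predU1P[->//|]; exact: wk.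
Qed.

End histories.

Lemma history_measurable {d' d : measure_display} {T : measurableType d'}
    {S : nat -> measurableType d} (xi : forall j, T -> S j) k :
  (forall j, measurable_fun setT (xi j)) -> history xi k `<=` measurable.
Proof.
move=> hxi; apply: smallest_sub; first exact: sigma_algebra_measurable.
by move=> _ [j _ [B mB <-]]; exact: hxi.
Qed.

(** * Conditional inequalities integrated over an event *)

Section conditional_bounds.
Context {d : measure_display} {T : measurableType d} {R : realType}.
Variables (P : probability T R).

Lemma ae_le_Rintegral (B : set T) (U V : T -> R) : measurable B ->
  P.-integrable setT (EFin \o U) -> P.-integrable setT (EFin \o V) ->
  (\forall w \ae P, U w <= V w) ->
  \int[P]_(w in B) U w <= \int[P]_(w in B) V w.
Proof.
move=> mB iU iV [N [mN PN UV]].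
have iUB : P.-integrable B (EFin \o U) by exact: (integrableS measurableT).
have iVB : P.-integrable B (EFin \o V) by exact: (integrableS measurableT).
rewrite /Rintegral fine_le//; [exact: integrable_fin_num|exact: integrable_fin_num|].
rewrite (negligible_integral mN mB iUB PN) (negligible_integral mN mB iVB PN).
have mBN : measurable (B `\` N) by exact: measurableD.
apply: le_integral => //; [exact: (integrableS measurableT)|exact: (integrableS measurableT)|].
move=> w; rewrite inE => -[_ nN]; rewrite lee_fin leNgt; apply/negP => VU.
by apply: nN; apply: UV => /=; rewrite leNgt VU.
Qed.

Lemma Rintegral_subset (B C : set T) (U : T -> R) : measurable B -> measurable C ->
  B `<=` C -> P.-integrable setT (EFin \o U) -> (forall w, 0 <= U w) ->
  \int[P]_(w in B) U w <= \int[P]_(w in C) U w.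
Proof.
move=> mB mC BC iU U0.
have iUB : P.-integrable B (EFin \o U) by exact: (integrableS measurableT).
have iUC : P.-integrable C (EFin \o U) by exact: (integrableS measurableT).
rewrite /Rintegral fine_le//; [exact: integrable_fin_num|exact: integrable_fin_num|].
apply: ge0_subset_integral => //.
- exact: measurable_int iUC.
- by move=> w _; rewrite lee_fin.
Qed.

(** On a set of the sub-sigma-algebra, a variable and its conditional expectation have the same
    integral, so integrating the almost sure inequality removes the conditioning. *)
Lemma condexp_bound (G : set (set T)) (B : set T) (Z U S Q : T -> R) (c : R) :
  <<s G >> `<=` measurable -> <<s G >> B ->
  P.-integrable setT (EFin \o Z) -> P.-integrable setT (EFin \o U) ->
  P.-integrable setT (EFin \o S) -> P.-integrable setT (EFin \o Q) ->
  (\forall w \ae P, condexp P <<s G >> Z w <=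
     U w + c * (condexp P <<s G >> S w + Q w)) ->
  \int[P]_(w in B) Z w <=
  \int[P]_(w in B) U w + c * (\int[P]_(w in B) S w + \int[P]_(w in B) Q w).
Proof.
move=> Gm GB iZ iU iS iQ le_ae; have mB := Gm _ GB.
have [_ icZ cZ] := condexpP Gm iZ; have [_ icS cS] := condexpP Gm iS.
have iSQ : P.-integrable setT (EFin \o (fun w => condexp P <<s G >> S w + Q w)).
  by apply: (eq_integrable measurableT) (integrableD measurableT icS iQ).
have icSQ : P.-integrable setT (EFin \o (fun w => c * (condexp P <<s G >> S w + Q w))).
  by apply: (eq_integrable measurableT) (integrableZl measurableT c iSQ).
have iR : P.-integrable setT
    (EFin \o (fun w => U w + c * (condexp P <<s G >> S w + Q w))).
  by apply: (eq_integrable measurableT) (integrableD measurableT iU icSQ).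
have := ae_le_Rintegral mB icZ iR le_ae.
have sub (V : T -> R) : P.-integrable setT (EFin \o V) -> P.-integrable B (EFin \o V).
  by move=> iV; exact: (integrableS measurableT).
rewrite RintegralD//; [|exact: sub|exact: sub].
rewrite RintegralZl//; [|exact: sub].
rewrite RintegralD//; [|exact: sub|exact: sub].
by rewrite /Rintegral cZ// cS.
Qed.

End conditional_bounds.

(** * Means of finite sums and of series *)

Section expectation.
Context {d : measure_display} {T : measurableType d} {R : realType}.
Variable P : probability T R.
Implicit Types (U V : T -> R) (a b : R).

(** Carrying integrability and value together lets the mean of a quadratic form be assembled term by
    term. *)
Definition has_mean U a :=
  P.-integrable setT (EFin \o U) /\ (\int[P]_w (U w)%:E = a%:E)%E.

Lemma has_mean_cst a : has_mean (fun=> a) a.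
Proof.
split; first exact: (finite_measure_integrable_cst P a measurableT).
rewrite integral_cst // -[RHS]mule1; congr (_ * _)%E; exact: probability_setT.
Qed.

Lemma has_meanD U V a b : has_mean U a -> has_mean V b ->
  has_mean (fun w => U w + V w) (a + b).
Proof.
move=> [iU aU] [iV bV]; split.
  by apply: (eq_integrable measurableT) (integrableD measurableT iU iV).
by under eq_integral do rewrite EFinD; rewrite integralD// aU bV.
Qed.

Lemma has_meanZ U a b : has_mean U a -> has_mean (fun w => b * U w) (b * a).
Proof.
move=> [iU aU]; split.
  by apply: (eq_integrable measurableT) (integrableZl measurableT b iU).
by under eq_integral do rewrite EFinM; rewrite integralZl// aU.
Qed.

Lemma has_mean_sum n (U : nat -> T -> R) (a : nat -> R) :
  (forall j, has_mean (U j) (a j)) ->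
  has_mean (fun w => \sum_(j < n) U j w) (\sum_(j < n) a j).
Proof.
move=> Ua; elim: n => [|n IH].
  by under eq_fun do rewrite big_ord0; rewrite big_ord0; exact: has_mean_cst.
under eq_fun do rewrite big_ord_recr/=; rewrite big_ord_recr/=.
exact: has_meanD.
Qed.

Lemma has_mean_ge0 U a : has_mean U a -> (forall w, 0 <= U w) -> 0 <= a.
Proof.
by move=> [_ aU] U0; rewrite -lee_fin -aU integral_ge0// => w _; rewrite lee_fin.
Qed.

Lemma has_mean_restrict U (B : set T) : measurable B ->
  P.-integrable setT (EFin \o U) ->
  has_mean (fun w => (w \in B)%:R * U w) (\int[P]_(w in B) U w).
Proof.
move=> mB iU.
have iB : P.-integrable B (EFin \o U) by exact: (integrableS measurableT).
have E : EFin \o (fun w => (w \in B)%:R * U w) = ((EFin \o U) \_ B)%E.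
  apply/funext => w; rewrite restrict_EFin /= patchE.
  by case: ifP => _; rewrite ?mul1r ?mul0r.
split; first by rewrite E; exact: (integrable_mkcond _ mB).1.
rewrite (eq_integral ((EFin \o U) \_ B)%E) => [|w _]; last by rewrite -E.
by rewrite -integral_mkcond /Rintegral fineK// integrable_fin_num.
Qed.

(** By monotone convergence the series has integral at most [b], hence is finite almost
    everywhere. *)
Lemma ae_summable (U : nat -> T -> R) (a : nat -> R) (b : R) :
  (forall k, has_mean (U k) (a k)) -> (forall k w, 0 <= U k w) ->
  (forall n, \sum_(k < n) a k <= b) ->
  \forall w \ae P, exists B, forall n, \sum_(k < n) U k w <= B.
Proof.
move=> Ua U0 ab.
have mU k : measurable_fun setT (EFin \o U k) by exact: measurable_int (Ua k).1.
pose Z w := (\sum_(k <oo) (U k w)%:E)%E.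
have Z0 w : (0 <= Z w)%E by apply: nneseries_ge0 => k _ _; rewrite lee_fin.
have mZ : measurable_fun setT Z.
  have U0E k w : (0 <= (U k w)%:E)%E by rewrite lee_fin.
  exact: (ge0_emeasurable_sum (P := xpredT) (fun k w _ _ => U0E k w) (fun k _ => mU k)).
have iZ : (\int[P]_w Z w <= b%:E)%E.
  rewrite /Z integral_nneseries//; last by move=> k w _; rewrite lee_fin.
  apply: lime_le.
    by apply: is_cvg_ereal_nneg_natsum => k _; apply: integral_ge0 => w _; rewrite lee_fin.
  apply: nearW => n; rewrite (eq_bigr (fun k => (a k)%:E)) => [|k _]; last exact: (Ua k).2.
  by rewrite big_mkord sumEFin lee_fin.
have intZ : P.-integrable setT Z.
  apply/integrableP; split => //; under eq_integral do rewrite gee0_abs//.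
  exact: le_lt_trans iZ (ltry _).
have := integrable_ae measurableT intZ; apply: filterS => w /(_ I) Zf.
exists (fine (Z w)) => n; rewrite -lee_fin fineK//.
rewrite -sumEFin -(big_mkord xpredT (fun k => (U k w)%:E)).
by apply: nneseries_lim_ge => k _ _; rewrite lee_fin.
Qed.

End expectation.

(** * Almost sure summability *)

(** The pathwise bound of [localized_energy], with the indicators of the events [E k], is averaged;
    the means then satisfy the variance recursion, and [ae_summable] returns to trajectories. *)
Lemma localized_summability (R : realType) (X Y : euclideanType R)
    (f : X -> R) (A : 'Hom(X, Y)) (h : Y -> \bar R) (D : set (Y * R)) (H : Y -> R)
    (L : R) (d : measure_display) (T : measurableType d) (P : probability T R)
    (d' : measure_display) (S : nat -> measurableType d') (xi : forall j, T -> S j)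
    (alpha : R) (x0 : X) (y0 : Y) (g x : nat -> T -> X) (y : nat -> T -> Y)
    (t : nat) (v : nat -> 'I_t -> T -> R) (sigma1 sigma2 sigmaL rho : R)
    (delta1 delta2 r : R) :
  0 < L -> (forall a, differentiable f a) ->
  (forall a b, `|grad f a - grad f b| <= L * `|a - b|) ->
  (forall y, conjugate h y = (H y)%:E) -> affine_sup D H ->
  (forall y, exists m, forall x, m <= f x + inner y (A x) - H y) ->
  (forall u, exists x, A x = u) ->
  (forall j, measurable_fun setT (xi j)) -> 0 < alpha ->
  (forall k, measurable_wrt (history xi k) (@borel X) (x k)) ->
  (forall k, measurable_wrt (history xi k) (@borel Y) (y k)) ->
  is_sppdg alpha A h x0 y0 g x y ->
  0 < sigma1 -> 0 < sigmaL -> 0 < rho ->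
  variance_reduced P (history xi) f x g v sigma1 sigma2 sigmaL rho ->
  0 < delta1 -> 0 < delta2 -> 0 < e0 alpha L delta1 delta2 sigma1 sigmaL rho ->
  \forall w \ae P, (forall k, bounded_event x y r k w) ->
    exists B, forall n, \sum_(k < n) (`|x k.+1 w - x k w| ^+ 2 +
      `|g k.+1 w - grad f (x k.+1 w)| ^+ 2) <= B.
Proof.
move=> L0 df lip HE DH lbH sA hxi a0 hx hy hiter s10 sL0 rho0 hvr d10 d20 he0.
pose E k := bounded_event x y r k.
have EF k : history xi k (E k) by exact: bounded_event_history.
have Fm k := @history_measurable _ _ _ _ _ k hxi.
have mE k : measurable (E k) by exact: Fm (EF k).
have EE k : E k.+1 `<=` E k by move=> w Ew j jk; apply: Ew; exact: leqW.
(* Shifted by one: index [k] stands for iteration [k.+1], since variance reduction is assumed for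
   positive indices. *)
pose Dx k w := primal_step x k.+1 w ^+ 2.
pose Er k w := grad_error f x g k.+1 w ^+ 2.
pose La k w := Lambda1 v k.+1 w.
have iD k : P.-integrable setT (EFin \o Dx k) by exact: (vr_step2_integrable hvr (ltn0Sn k)).
have iE k : P.-integrable setT (EFin \o Er k) by exact: (vr_error2_integrable hvr (ltn0Sn k)).
have iL k : P.-integrable setT (EFin \o La k) by exact: (vr_Lambda1_integrable hvr (ltn0Sn k)).
have Dx0 k w : 0 <= Dx k w by exact: sqr_ge0.
have Er0 k w : 0 <= Er k w by exact: sqr_ge0.
have La0 k w : 0 <= La k w by apply: sumr_ge0 => i _; exact: sqr_ge0.
(* The event is that of the starting point: [E k] for the step from [x k], but [E k.+1] for the
   error and [Lambda1] at [x k.+1]. *)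
pose mD k := \int[P]_(w in E k) Dx k w.
pose mV k := \int[P]_(w in E k.+1) Er k w.
pose mM k := \int[P]_(w in E k.+1) La k w.
have mDQ k : \int[P]_(w in E k.+1) Dx k w <= mD k by exact: Rintegral_subset.
have VM k : mV k <= mM k + sigma1 * (mD k.+1 + mD k).
  have := condexp_bound (Fm k.+1) (EF k.+1) (iE k) (iL k) (iD k.+1) (iD k)
    (vr_mean_square hvr (ltn0Sn k)).
  by move=> /le_trans; apply; rewrite lerD2l ler_pM2l// lerD2l.
have MM k : mM k.+1 <= (1 - rho) * mM k + sigmaL * (mD k.+1 + mD k).
  have iL' : P.-integrable setT (EFin \o (fun w => (1 - rho) * La k w)).
    by apply: (eq_integrable measurableT) (integrableZl measurableT (1 - rho) (iL k)).
  have := condexp_bound (Fm k.+1) (EF k.+1) (iL k.+1) iL' (iD k.+1) (iD k)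
    (vr_decay hvr (ltn0Sn k)).
  rewrite RintegralZl//; last exact: (integrableS measurableT).
  move=> H1; apply: le_trans (le_trans H1 _); first exact: Rintegral_subset.
  by rewrite lerD2l ler_pM2l// lerD2l.
have [K KP] := localized_energy r a0 L0 df lip DH lbH d10 d20.
pose u k w := (w \in E k)%:R * Dx k w.
pose e k w := (w \in E k.+1)%:R * Er k w.
have uM k : has_mean P (u k) (mD k) := has_mean_restrict (mE k) (iD k).
have eM k : has_mean P (e k) (mV k) := has_mean_restrict (mE k.+1) (iE k).
have qM j : has_mean P (fun w =>
    - (alpha^-1 - (delta1 + L) / 2) * u j.+3 w + (2 * delta1)^-1 * e j.+2 w
    + 2 * delta2 / alpha * ((1 + alpha * L) ^+ 2 * u j.+2 w + u j.+3 w
                        + alpha ^+ 2 * (e j.+2 w + e j.+1 w))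
    + 3 * alpha / (2 * delta2) * (e j.+1 w + e j w + L ^+ 2 * u j.+1 w))
  (- (alpha^-1 - (delta1 + L) / 2) * mD j.+3 + (2 * delta1)^-1 * mV j.+2
    + 2 * delta2 / alpha * ((1 + alpha * L) ^+ 2 * mD j.+2 + mD j.+3
                        + alpha ^+ 2 * (mV j.+2 + mV j.+1))
    + 3 * alpha / (2 * delta2) * (mV j.+1 + mV j + L ^+ 2 * mD j.+1)).
  apply: has_meanD; last first.
    apply: has_meanZ; apply: has_meanD; last by apply: has_meanZ; exact: uM.
    by apply: has_meanD; exact: eM.
  apply: has_meanD; last first.
    apply: has_meanZ; apply: has_meanD; last first.
      by apply: has_meanZ; apply: has_meanD; exact: eM.
    by apply: has_meanD; [apply: has_meanZ; exact: uM|exact: uM].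
  by apply: has_meanD; apply: has_meanZ; [exact: uM|exact: eM].
have sumQ n := has_mean_ge0 (has_meanD (has_mean_cst P K) (has_mean_sum n qM)) (fun w =>
  KP (g^~ w) (x^~ w) (y^~ w) (fun k => w \in E k)
  (fun k => sppdg_x hiter k w) (sppdg_subgradient w a0 sA HE DH hiter)
  (fun k Ek => mem_set (EE k w (set_mem Ek))) (fun k Ek => set_mem Ek k (leqnn k)) n).
have mD0 k : 0 <= mD k by exact: Rintegral_ge0.
have mV0 k : 0 <= mV k by exact: Rintegral_ge0.
have mM0 k : 0 <= mM k by exact: Rintegral_ge0.
have c10 : 0 <= (2 * delta1)^-1 by rewrite invr_ge0 mulr_ge0// ltW.
have k10 : 0 <= 2 * delta2 / alpha by rewrite divr_ge0 ?mulr_ge0 ?ltW.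
have k20 : 0 <= 3 * alpha / (2 * delta2) by rewrite divr_ge0 ?mulr_ge0 ?ltW.
have egt0 : 0 < 3 * e0 alpha L delta1 delta2 sigma1 sigmaL rho by rewrite mulr_gt0.
(* With the predecessor, [V k.+1] and [M k.+1] of the recursion are [mV k] and [mM k]. *)
have [|B HB] := variance_recursion_summable (V := fun k => mV k.-1)
  (M := fun k => mM k.-1) mD0 (fun k => mV0 k.-1) (fun k => mM0 k.-1)
  (ltW s10) (ltW sL0) rho0 c10 k10 k20 (sqr_ge0 _) (sqr_ge0 _) (sqr_ge0 _) VM MM sumQ.
  (* The margin of the recursion is exactly [3 * e0]. *)
  apply: lt_le_trans egt0 _; rewrite le_eqVlt; apply/orP; left; apply/eqP.
  by rewrite /e0; field; rewrite !gt_eqF.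
have u0 k w : 0 <= u k w by rewrite mulr_ge0.
have e_0 k w : 0 <= e k w by rewrite mulr_ge0.
have := ae_summable (fun k => has_meanD (uM k) (eM k)) (fun k w => addr_ge0 (u0 k w) (e_0 k w)) HB.
apply: filterS => w [B' HB'] Ew; exists B' => n; apply: le_trans (HB' n).
apply: ler_sum => k _; rewrite /u /e !mem_set ?mul1r//; exact: Ew.
Qed.

(** * Assembly over all radii *)

Theorem theorem3p10 (R : realType) (X Y : euclideanType R)
    (N : nat) (hN : (0 < N)%N) (fi : 'I_N -> X -> R)
    (hC1 : forall i, C1 (fi i))
    (A : 'Hom(X, Y))
    (h : Y -> \bar R) (hh : forall u, (-oo < h u)%E)
    (* standing assumptions on the problem *)
    (L : R) (hL : 0 < L)
    (hB1 : forall i a b,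
      `|grad (fi i) a - grad (fi i) b| <= L * `|a - b|)
    (hB2 : forall y,
      (-oo < ereal_inf [set Ls (average fi) A h x y | x in setT])%E)
    (hB3 : forall u, exists x, A x = u)
    (hB4 : proper_fun (convex_hull_fun h))
    (* the probability space and the random variables of each iteration *)
    (d : measure_display) (T : measurableType d) (P : probability T R)
    (d' : measure_display) (S : nat -> measurableType d')
    (xi : forall j, T -> S j)
    (hxi : forall j, measurable_fun setT (xi j))
    (* the SPPDG iteration *)
    (alpha : R) (halpha : 0 < alpha) (x0 : X) (y0 : Y)
    (g x : nat -> T -> X) (y : nat -> T -> Y)
    (hg : forall k, measurable_wrt (history xi k.+1) (@borel X) (g k))
    (hx : forall k, measurable_wrt (history xi k) (@borel X) (x k))
    (hy : forall k, measurable_wrt (history xi k) (@borel Y) (y k))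
    (hiter : is_sppdg alpha A h x0 y0 g x y)
    (* variance reduction *)
    (t : nat) (v : nat -> 'I_t -> T -> R)
    (sigma1 sigma2 sigmaL rho : R)
    (hsigma1 : 0 < sigma1) (hsigma2 : 0 < sigma2) (hsigmaL : 0 < sigmaL)
    (hrho0 : 0 < rho) (hrho1 : rho <= 1)
    (hvr : variance_reduced P (history xi) (average fi) x g v
             sigma1 sigma2 sigmaL rho)
    (delta1 delta2 : R) (hdelta1 : 0 < delta1) (hdelta2 : 0 < delta2)
    (he0 : 0 < e0 alpha L delta1 delta2 sigma1 sigmaL rho)
    (hbounded : exists B : set T, [/\ measurable B, P B = 1%E &
      forall w, B w -> bounded_fun (fun k : nat => (x k w, y k w))]) :
  exists Omega : set T, [/\ measurable Omega, P Omega = 1%E &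
    forall w, Omega w ->
      let C := cluster_points (fun k : nat => (x k w, y k w)) in
      [/\ C !=set0 /\ compact C,
          dist_set (x k w, y k w) C @[k --> \oo] --> (0 : R),
          C `<=` crit_Ls (average fi) A h &
          exists c : R, forall z, C z -> Ls (average fi) A h z.1 z.2 = c%:E]].
Proof.
pose f := average fi; pose H := fine \o conjugate h.
have df a : differentiable f a := (grad_average (fun i => (hC1 i).1 a)).1.
have lip := grad_average_lipschitz hN (fun i => (hC1 i).1) hB1.
have cf u : conjugate h u \is a fin_num := conjugate_fin_num hh hB4 (hB2 u).
have HE u : conjugate h u = (H u)%:E by rewrite /H/= fineK.
have DH := affine_sup_conjugate hh cf.
have lbH u : exists m, forall a, m <= f a + inner u (A a) - H u.
  pose i := ereal_inf [set Ls f A h a u | a in setT].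
  have iL a : (i <= (f a + inner u (A a) - H u)%:E)%E.
    by rewrite EFinB -HE; apply: ereal_inf_lbound; exists a.
  have ifin : i \is a fin_num.
    by rewrite fin_numE gt_eqF ?(hB2 u)// lt_eqF// (le_lt_trans (iL 0))// ltry.
  by exists (fine i) => a; rewrite -lee_fin fineK.
(* Natural radii reach every bounded trajectory, and a countable union of null sets is null. *)
have : \forall w \ae P, forall r : nat, (forall k, bounded_event x y r%:R k w) ->
    exists B, forall n, \sum_(k < n) (`|x k.+1 w - x k w| ^+ 2 +
      `|g k.+1 w - grad f (x k.+1 w)| ^+ 2) <= B.
  apply: ae_foralln => r.
  exact: (localized_summability r%:R hL df lip HE DH lbH hB3 hxi halpha hx hy
    hiter hsigma1 hsigmaL hrho0 hvr hdelta1 hdelta2 he0).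
case=> Z [mZ PZ sumZ]; have [B [mB PB Bbd]] := hbounded.
exists (B `\` Z); split; first exact: measurableD.
  apply/eqP; rewrite -PB (measureDI P mB mZ) eq_sym -[X in _ == X]adde0; apply/eqP.
  congr (_ + _)%E; apply/eqP; rewrite eq_le measure_ge0 andbT -PZ.
  by apply: le_measure; rewrite ?inE//; exact: measurableI.
move=> w [Bw nZw] C.
have [M [_ Mz]] := Bbd w Bw.
(* A natural number strictly above [M], because [bounded_fun] gives the bound only for values larger
   than [M]. *)
pose r : R := (Num.truncn (`|M| + 1)).+1%:R.
have zr k : `|(x k w, y k w)| <= r.
  apply: Mz => //; apply: lt_trans (truncnS_gt _).
  by rewrite (le_lt_trans (ler_norm _))// ltrDl.
have [cne ccomp] := cluster_points_compact zr.
have [S' sumS] : exists B, forall n, \sum_(k < n) (`|x k.+1 w - x k w| ^+ 2 +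
      `|g k.+1 w - grad f (x k.+1 w)| ^+ 2) <= B.
  apply: contrapT => nS; apply: nZw; apply: sumZ => /= H'; apply: nS.
  apply: (H' (Num.truncn (`|M| + 1)).+1) => k j _.
  by have := zr j; rewrite prod_normE/= ge_max => /andP[].
have [crit const] := path_cluster_points halpha hL df lip (fun k => sppdg_x hiter k w)
  (sppdg_subgradient w halpha hB3 HE DH hiter) HE DH lbH zr sumS.
by split => //; exact: dist_set_cluster_points_cvg zr.
Qed.
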